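(* Let $\mathsf{T}$ be a p-string of length $n$ over $\Sigma_s \cup \Sigma_p$ with $\mathsf{T}[n] = \$$, and let $\mathsf{L}$ be the pBWT of $\mathsf{T}$. Given $\mathsf{L}$ only, one can compute in $O(n^2)$ time and $O(n)$ space a p-string that p-matches $\mathsf{T}$.
   Context: Let $\Sigma_s$ (static symbols) and $\Sigma_p$ (parameter symbols) be disjoint finite ordered alphabets. $\Sigma_s$ is disjoint from the integers, and every s-symbol is smaller than every integer. A p-string is a string over $\Sigma_s\cup\Sigma_p$. Two p-strings $x,y$ p-match if $y$ is obtained from $x$ by applying a bijection of $\Sigma_p$ to every occurrence of a p-symbol in $x$ (s-symbols are unchanged). The prev-encoding $\langle w\rangle$ of a p-string $w$ of length $m$ is the string of length $m$ with $\langle w\rangle[i]=w[i]$ if $w[i]\in\Sigma_s$; $\langle w\rangle[i]=0$ if $w[i]\in\Sigma_p$ does not occur in $w[1..i-1]$; and $\langle w\rangle[i]=i-j$ otherwise, where $j$ is the largest position in $[1..i-1]$ with $w[j]=w[i]$. Write $\mathrm{zeros}(X)$ for the number of occurrences of $0$ in $X$. Strings are compared lexicographically, with a proper prefix smaller than any extension. $\mathsf{T}$ is a p-string of length $n$ with $\mathsf{T}[n]=\$$, where $\$$ is the smallest s-symbol and does not occur elsewhere in $\mathsf{T}$. For an integer $i$, $\mathsf{T}_i=\mathsf{T}[i'..n]\mathsf{T}[1..i'-1]$, where $i'\in[1..n]$ and $i'\equiv i \pmod n$. Let $\tau$ be the permutation of $[1..n]$ such that $\langle \mathsf{T}_{\tau[i]}\rangle$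 is the $i$-th lexicographically smallest string among $\{\langle \mathsf{T}_{i'}\rangle\}_{i'=1}^n$. The pBWT of $\mathsf{T}$ is the string $\mathsf{L}$ of length $n$ defined by: - $\mathsf{L}[i]=\mathsf{T}_{\tau[i]}[n]$ if $\mathsf{T}_{\tau[i]}[n]\in\Sigma_s$; - otherwise $\mathsf{L}[i]=\mathrm{zeros}(\langle \mathsf{T}_{\tau[i]}[1..j]\rangle)$, where $j$ is the smallest position with $\mathsf{T}_{\tau[i]}[j]=\mathsf{T}_{\tau[i]}[n]$. Time is measured on a word RAM, and space in machine words. *)

(* Defs.v *)
From HB Require Import structures.
From mathcomp Require Import all_boot all_order all_fingroup.

Set Implicit Arguments.
Unset Strict Implicit.
Unset Printing Implicit Defensive.

Section PStrings.

Variables (ds dp : Order.disp_t).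
Variables (Ss : finOrderType ds) (Sp : finOrderType dp).

Implicit Types (x : Ss + Sp) (w T R : seq (Ss + Sp)) (X Y : seq (Ss + nat)).

Definition subst_param (f : {perm Sp}) x : Ss + Sp :=
  match x with inl a => inl a | inr p => inr (f p) end.

Definition p_match w1 w2 : Prop :=
  exists f : {perm Sp}, w2 = map (subst_param f) w1.

(* Encoding of the symbol x preceded by the prefix u.  If the last occurrence
   of x in u is at position j and x itself is at position i, then x has index
   i - j - 1 in rev u. *)
Definition prev_symbol (u : seq (Ss + Sp)) x : Ss + nat :=
  match x with
  | inl a => inl a
  | inr _ => if x \in u then inr (index x (rev u)).+1 else inr 0
  end.

Fixpoint prev_from (u w : seq (Ss + Sp)) : seq (Ss + nat) :=
  if w is x :: w' then prev_symbol u x :: prev_from (rcons u x) w' else [::].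

Definition prev_enc w := prev_from [::] w.

Definition zeros X : nat := count_mem (inr 0) X.

Definition symb_lt (x y : Ss + nat) : bool :=
  match x, y with
  | inl a, inl b => (a < b)%O
  | inl _, inr _ => true
  | inr _, inl _ => false
  | inr k, inr l => k < l
  end.

Fixpoint lex_le X Y : bool :=
  match X, Y with
  | [::], _ => true
  | _ :: _, [::] => false
  | x :: X', y :: Y' => symb_lt x y || ((x == y) && lex_le X' Y')
  end.

(* T_i, for i in [1..size T] *)
Definition rotation T (i : nat) := rot i.-1 T.

Definition tau T : seq nat :=
  sort (fun i j => lex_le (prev_enc (rotation T i)) (prev_enc (rotation T j)))
       (iota 1 (size T)).

(* The default value of last is never used: R is a rotation of a nonempty T. *)
Definition pBWT_symbol (dollar : Ss) R : Ss + nat :=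
  match last (inl dollar) R with
  | inl a => inl a
  | inr p => inr (zeros (prev_enc (take (index (inr p) R).+1 R)))
  end.

Definition pBWT (dollar : Ss) T : seq (Ss + nat) :=
  [seq pBWT_symbol dollar (rotation T i) | i <- tau T].

Definition terminated (dollar : Ss) T : Prop :=
  exists2 T', T = rcons T' (inl dollar) & inl dollar \notin T'.

(* One machine word per symbol.  A symbol of a finite ordered alphabet is
   represented by its rank; the lowest bit tells s-symbols (0) from integers or
   p-symbols (1), so that no information on the alphabets is needed to decode. *)
Definition code_s (a : Ss) : nat := (Order.enum_rank a).*2.

Definition code_L (x : Ss + nat) : nat :=
  match x with inl a => code_s a | inr k => k.*2.+1 end.

Definition code_p x : nat :=
  match x with inl a => code_s a | inr p => (Order.enum_rank p).*2.+1 end.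

End PStrings.

(* Word RAM with w-bit words: finitely many registers per program (those it
   mentions) and a memory of m words.  Every instruction costs one time unit. *)

Inductive binop : Type :=
  | OpAdd | OpSub | OpMul | OpDiv | OpMod | OpAnd | OpOr | OpXor | OpShl | OpShr.

(* In the comments on the right, r, a, b stand for the contents of these
   registers, and M for the memory. *)
Inductive instr : Type :=
  | Const (r k : nat)                (* r := k *)
  | Op (o : binop) (r a b : nat)     (* r := a o b *)
  | Ldr (r a : nat)                  (* r := M[a] *)
  | Str (a b : nat)                  (* M[a] := b *)
  | Jmp (l : nat)                    (* goto l *)
  | Jlt (a b l : nat)                (* if a < b goto l *)
  | Jeq (a b l : nat)                (* if a = b goto l *)
  | Halt.

Definition program := seq instr.

Record state : Type :=
  State { st_pc : nat; st_regs : nat -> nat; st_mem : nat -> nat }.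

Definition upd (f : nat -> nat) (k v : nat) : nat -> nat :=
  fun i => if i == k then v else f i.

Definition eval_op (w : nat) (o : binop) (x y : nat) : nat :=
  match o with
  | OpAdd => x + y
  | OpSub => x + (2 ^ w - y)
  | OpMul => x * y
  | OpDiv => x %/ y
  | OpMod => x %% y
  | OpAnd => Nat.land x y
  | OpOr => Nat.lor x y
  | OpXor => Nat.lxor x y
  | OpShl => x * 2 ^ y
  | OpShr => x %/ 2 ^ y
  end %% 2 ^ w.

(* None: the machine has halted, or has faulted because the program counter is
   outside the program or an address is outside the memory of m words. *)
Definition step (w m : nat) (P : program) (s : state) : option state :=
  let: State i R M := s in
  match onth P i with
  | Some (Const r k) => Some (State i.+1 (upd R r (k %% 2 ^ w)) M)
  | Some (Op o r a b) => Some (State i.+1 (upd R r (eval_op w o (R a) (R b))) M)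
  | Some (Ldr r a) =>
      if R a < m then Some (State i.+1 (upd R r (M (R a))) M) else None
  | Some (Str a b) =>
      if R a < m then Some (State i.+1 R (upd M (R a) (R b))) else None
  | Some (Jmp l) => Some (State l R M)
  | Some (Jlt a b l) => Some (State (if R a < R b then l else i.+1) R M)
  | Some (Jeq a b l) => Some (State (if R a == R b then l else i.+1) R M)
  | Some Halt | None => None
  end.

Fixpoint steps (w m : nat) (P : program) (k : nat) (s : state) : option state :=
  if k is k'.+1 then obind (steps w m P k') (step w m P s) else Some s.

(* The input string occupies the first memory cells and its length is in
   register 0; everything else is 0. *)
Definition input_state (w : nat) (input : seq nat) : state :=
  State 0 (upd (fun=> 0) 0 (size input %% 2 ^ w))
        (fun i => nth 0 input i %% 2 ^ w).

(* On this input P halts (at a Halt instruction, without fault) after at most t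
   instructions, in a memory of m words that has to hold the input as well, with
   the output string in the first memory cells. *)
Definition ram_computes (w m t : nat) (P : program) (input output : seq nat) :
    Prop :=
  [/\ size input <= m, size output <= m &
      exists (k : nat) (s : state),
        [/\ k <= t, steps w m P k (input_state w input) = Some s,
            onth P (st_pc s) = Some Halt &
            mkseq (st_mem s) (size output) = output]].

(* Main.v *)
Require Import Defs.
From mathcomp Require Import all_boot all_order all_fingroup zify.

(* The text is recovered from right to left.  For the known suffix u, let P be
   its prev-encoding, and call rows the sorted encoded rotations.  For each row
   record a key: the position of its first difference with P, on which side of P
   the row lies, and, if it is smaller, whether its differing symbol is static,
   0, or positive.  Keys can be coded by numbers at most 4 n so that they grow
   with the lexicographic order.  Prepending the last symbol of a rotation to it
   changes its encoding only at the first occurrence of that symbol, where a 0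
   becomes an integer larger than anything it competes with; so the key of the
   rotation that starts one position earlier is a function of the old key, of
   the two entries of L, and of the positions of 0 in P.  The array of keys for
   the next suffix is therefore obtained by sorting these new keys, without
   knowing the LF-mapping, and the row that has P as a prefix shows the next
   symbol in L.  With counting sort a round takes O(n) time and space. *)

Set Implicit Arguments.
Unset Strict Implicit.
Unset Printing Implicit Defensive.

(** * A structured language compiled to the word RAM *)

(** A key stops at the first mismatch [l], and this is enough: before [l] a row and [P] have the
    same zeros, so the zero that prepending rewrites in the row can be located in [P], and one at or
    beyond [l] matters only if it is at [l] itself. There a 0 may be rewritten and turn a smaller
    row into a larger one, while a static symbol or a positive integer never changes; hence the
    classes. A larger row needs none: above a 0 of [P] that is rewritten it can only hold a positive
    integer. Sorting can replace the LF-mapping because keys are weakly monotone in the order of the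
    rows and stepping back permutes the rotations: the next array is sorted, and its multiset of
    values is known. The p-symbols are recovered only up to names, so each newly met one gets the
    next free number, and a permutation of [Sp] realises these names at the end. The RAM part goes
    through a small language with exact arithmetic, so that words and addresses appear only in side
    conditions. *)

Inductive exp : Type :=
  | Cst (k : nat)
  | Var (r : nat)
  | Bin (o : binop) (e1 e2 : exp)
  | Deref (e : exp).

(* The boolean of a test selects [<] (true) or [=] (false). *)
Inductive cmd : Type :=
  | Asg (r : nat) (e : exp)
  | Sto (e1 e2 : exp)
  | Seq (c1 c2 : cmd)
  | If (t : bool) (e1 e2 : exp) (c1 c2 : cmd)
  | While (t : bool) (e1 e2 : exp) (c : cmd).

(* Variables are the registers below nvar; the registers from nvar on form the
   evaluation stack of expressions. *)
Definition nvar := 16.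

(** A register is copied by [OpOr] of it with itself, since the machine has no move instruction. *)
Fixpoint cexp (d : nat) (e : exp) : seq instr :=
  match e with
  | Cst k => [:: Const d k]
  | Var r => [:: Op OpOr d r r]
  | Bin o e1 e2 => cexp d e1 ++ cexp d.+1 e2 ++ [:: Op o d d d.+1]
  | Deref e => cexp d e ++ [:: Ldr d d]
  end.

Definition cexp2 (e1 e2 : exp) := cexp nvar e1 ++ cexp nvar.+1 e2.

Definition jump (t : bool) (l : nat) : instr :=
  if t then Jlt nvar nvar.+1 l else Jeq nvar nvar.+1 l.

Definition test (t : bool) (x y : nat) : bool := if t then x < y else x == y.

Fixpoint csize (c : cmd) : nat :=
  match c with
  | Asg _ e => (size (cexp nvar e)).+1
  | Sto e1 e2 => (size (cexp2 e1 e2)).+1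
  | Seq c1 c2 => csize c1 + csize c2
  | If _ e1 e2 c1 c2 => size (cexp2 e1 e2) + (csize c2).+2 + csize c1
  | While _ e1 e2 c => size (cexp2 e1 e2) + (csize c).+3
  end.

(* [compile b c] is the code of [c], to be placed at address [b]. *)
Fixpoint compile (b : nat) (c : cmd) : seq instr :=
  match c with
  | Asg r e => cexp nvar e ++ [:: Op OpOr r nvar nvar]
  | Sto e1 e2 => cexp2 e1 e2 ++ [:: Str nvar nvar.+1]
  | Seq c1 c2 => compile b c1 ++ compile (b + csize c1) c2
  | If t e1 e2 c1 c2 =>
      let b2 := (b + size (cexp2 e1 e2)).+1 in
      let b1 := (b2 + csize c2).+1 in
      cexp2 e1 e2 ++ jump t b1 :: compile b2 c2
        ++ Jmp (b1 + csize c1) :: compile b1 c1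
  | While t e1 e2 c =>
      let b1 := (b + size (cexp2 e1 e2)).+2 in
      cexp2 e1 e2 ++ jump t b1 :: Jmp (b1 + csize c).+1 :: compile b1 c
        ++ [:: Jmp b]
  end.

Lemma size_compile b c : size (compile b c) = csize c.
Proof.
elim: c b => [r e|e1 e2|c1 IH1 c2 IH2|t e1 e2 c1 IH1 c2 IH2|t e1 e2 c IH] b /=;
  rewrite !size_cat /= ?addn1 ?IH1 ?IH2 //.
  by rewrite size_cat /= IH1 IH2; lia.
by rewrite size_cat /= IH; lia.
Qed.

(** Exact arithmetic, without reduction modulo the word size. The bitwise operations get a dummy
    value and are ruled out by [op_safe]. *)
Definition op_val (o : binop) (x y : nat) : nat :=
  match o with
  | OpAdd => x + y
  | OpSub => x - y
  | OpMul => x * y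
  | OpDiv => x %/ y
  | OpMod => x %% y
  | _ => 0
  end.

Fixpoint eval (V M : nat -> nat) (e : exp) : nat :=
  match e with
  | Cst k => k
  | Var r => V r
  | Bin o e1 e2 => op_val o (eval V M e1) (eval V M e2)
  | Deref e => M (eval V M e)
  end.

Definition embedded (P : program) (b : nat) (c : seq instr) : Prop :=
  forall i, i < size c -> onth P (b + i) = onth c i.

Lemma embedded_cat P b c1 c2 : embedded P b (c1 ++ c2) ->
  embedded P b c1 /\ embedded P (b + size c1) c2.
Proof.
move=> E; split=> i Hi.
  by rewrite E ?size_cat ?onth_cat ?Hi //; lia.
rewrite -addnA E ?size_cat ?ltn_add2l // onth_cat ifF; last by lia.
by rewrite addKn.
Qed.

Lemma embedded_cons P b i c : embedded P b (i :: c) ->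
  onth P b = Some i /\ embedded P b.+1 c.
Proof.
move=> E; split; first by have := E 0 (ltn0Sn _); rewrite addn0.
by move=> j Hj; rewrite addSnnS (E j.+1).
Qed.

(** * Timed triples for compiled code *)

Section Machine.

Variables (w m : nat).

(* Sufficient for the machine operation, which works modulo 2 ^ w, to agree
   with op_val. *)
Definition op_safe (o : binop) (x y : nat) : Prop :=
  match o with
  | OpAdd | OpMul => op_val o x y < 2 ^ w
  | OpSub => y <= x
  | OpDiv | OpMod => True
  | _ => False
  end.

Fixpoint safe (V M : nat -> nat) (e : exp) : Prop :=
  match e with
  | Cst k => k < 2 ^ w
  | Var r => r < nvar
  | Bin o e1 e2 =>
      [/\ safe V M e1, safe V M e2 & op_safe o (eval V M e1) (eval V M e2)]
  | Deref e => safe V M e /\ eval V M e < m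
  end.

Definition words (f : nat -> nat) := forall i, f i < 2 ^ w.

Lemma words_upd f k v : words f -> v < 2 ^ w -> words (upd f k v).
Proof. by move=> Hf Hv i; rewrite /upd; case: ifP. Qed.

Lemma eval_op_val o x y :
  x < 2 ^ w -> y < 2 ^ w -> op_safe o x y -> eval_op w o x y = op_val o x y.
Proof.
rewrite /eval_op => Hx Hy; case: o => //= Hs; try exact: modn_small.
- by rewrite addnBA ?(ltnW Hy) // addnC -addnBA // modnDl modn_small //; lia.
- exact/modn_small/(leq_ltn_trans (leq_div _ _)).
- exact/modn_small/(leq_ltn_trans (leq_mod _ _)).
Qed.

Lemma steps_add P k1 k2 s :
  steps w m P (k1 + k2) s = obind (steps w m P k2) (steps w m P k1 s).
Proof.
by elim: k1 s => //= k1 IH s; case: (step w m P s) => //= s'; rewrite IH.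
Qed.

Lemma stepsS P k s s' : step w m P s = Some s' ->
  steps w m P k.+1 s = steps w m P k s'.
Proof. by move=> /= ->. Qed.

Lemma steps_trans P k1 k2 s1 s2 s3 : steps w m P k1 s1 = Some s2 ->
  steps w m P k2 s2 = Some s3 -> steps w m P (k1 + k2) s1 = Some s3.
Proof. by move=> H1 H2; rewrite steps_add H1. Qed.

Lemma cexp_correct P (V M : nat -> nat) e : safe V M e -> words M ->
  forall b d R, embedded P b (cexp d e) -> nvar <= d ->
  (forall r, r < nvar -> R r = V r) -> words R ->
  exists R', [/\ steps w m P (size (cexp d e)) (State b R M)
                   = Some (State (b + size (cexp d e)) R' M),
                 R' d = eval V M e, forall r, r < d -> R' r = R r & words R'].
Proof.
move=> + wM; elim: e => [k|r|o e1 IH1 e2 IH2|e IH] /= S b d R E Hd HV wR.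
- have [E0 _] := embedded_cons E.
  exists (upd R d k); split; rewrite ?E0 ?modn_small ?addn1 //.
  + by rewrite /upd eqxx.
  + by move=> r Hr; rewrite /upd ifF //; lia.
  + exact: words_upd.
- have [E0 _] := embedded_cons E.
  exists (upd R d (R r)); split; rewrite ?E0 /= ?addn1 //.
  + by rewrite /eval_op PeanoNat.Nat.lor_diag modn_small.
  + by rewrite /upd eqxx HV.
  + by move=> r' Hr; rewrite /upd ifF //; lia.
  + exact: words_upd.
- case: S => S1 S2 S3; rewrite !size_cat /=.
  have [E1 /embedded_cat[E2 /embedded_cons[E3 _]]] := embedded_cat E.
  have [R1 [H1 v1 f1 w1]] := IH1 S1 _ _ _ E1 Hd HV wR.
  have HV1 r : r < nvar -> R1 r = V r by move=> Hr; rewrite f1 ?HV //; lia.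
  have [R2 [H2 v2 f2 w2]] := IH2 S2 _ _ _ E2 (leqW Hd) HV1 w1.
  exists (upd R2 d (eval_op w o (R2 d) (R2 d.+1))); split.
  + apply: steps_trans H1 _; apply: steps_trans H2 _ => /=; rewrite E3 /=.
    by rewrite !addnA addn1.
  + rewrite /upd eqxx v2 (f2 _ (ltnSn d)) v1; apply: eval_op_val => //.
      by rewrite -v1.
    by rewrite -v2.
  + by move=> r Hr; rewrite /upd ifF ?f2 ?f1 //; lia.
  + by apply: words_upd => //; rewrite ltn_mod expn_gt0.
- case: S => S1 S2; rewrite !size_cat /=.
  have [E1 /embedded_cons[E3 _]] := embedded_cat E.
  have [R1 [H1 v1 f1 w1]] := IH S1 _ _ _ E1 Hd HV wR.
  exists (upd R1 d (M (R1 d))); split.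
  + by apply: steps_trans H1 _ => /=; rewrite E3 v1 S2 /= addnA addn1.
  + by rewrite /upd eqxx v1.
  + by move=> r Hr; rewrite /upd ifF ?f1 //; lia.
  + exact: words_upd.
Qed.

Lemma cexp2_correct P (V M : nat -> nat) e1 e2 b R :
  safe V M e1 -> safe V M e2 -> words M -> embedded P b (cexp2 e1 e2) ->
  (forall r, r < nvar -> R r = V r) -> words R ->
  exists R', [/\ steps w m P (size (cexp2 e1 e2)) (State b R M)
                   = Some (State (b + size (cexp2 e1 e2)) R' M),
                 R' nvar = eval V M e1, R' nvar.+1 = eval V M e2,
                 forall r, r < nvar -> R' r = V r & words R'].
Proof.
move=> S1 S2 wM E HV wR; have [E1 E2] := embedded_cat E.
have [R1 [H1 v1 f1 w1]] := cexp_correct S1 wM E1 (leqnn _) HV wR.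
have HV1 r : r < nvar -> R1 r = V r by move=> Hr; rewrite f1 ?HV.
have [R2 [H2 v2 f2 w2]] := cexp_correct S2 wM E2 (leqnSn _) HV1 w1.
exists R2; split => //; last 1 first.
- by move=> r Hr; rewrite f2 ?HV1 //; apply: ltnW.
- by rewrite /cexp2 size_cat addnA; apply: steps_trans H1 H2.
- by rewrite f2 ?v1.
Qed.

(** A total-correctness triple with a time bound, valid wherever the code is placed in a program.
    Only registers below [nvar] are tied to [V'], so the evaluation stack may end with any words. *)
Definition runs (t : nat) (c : cmd) (V M : nat -> nat)
    (Q : (nat -> nat) -> (nat -> nat) -> Prop) : Prop :=
  forall P b R, embedded P b (compile b c) ->
  (forall r, r < nvar -> R r = V r) -> words R -> words M ->
  exists k R' V' M',
    [/\ k <= t, steps w m P k (State b R M) = Some (State (b + csize c) R' M'),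
        forall r, r < nvar -> R' r = V' r, words R' & words M' /\ Q V' M'].

Lemma runs_weaken t t' c V M (Q Q' : (nat -> nat) -> (nat -> nat) -> Prop) :
  runs t c V M Q -> t <= t' -> (forall V M, Q V M -> Q' V M) ->
  runs t' c V M Q'.
Proof.
move=> H Ht HQ P b R E HV wR wM.
have [k [R' [V' [M' [? ? ? ? [? ?]]]]]] := H P b R E HV wR wM.
by exists k, R', V', M'; split => //; [lia | split => //; apply: HQ].
Qed.

Lemma runs_seq t1 t2 c1 c2 V M Q :
  runs t1 c1 V M (fun V' M' => runs t2 c2 V' M' Q) ->
  runs (t1 + t2) (Seq c1 c2) V M Q.
Proof.
move=> H P b R /= /embedded_cat[E1]; rewrite size_compile => E2 HV wR wM.
have [k1 [R1 [V1 [M1 [? H1 HV1 wR1 [wM1 H2]]]]]] := H P b R E1 HV wR wM.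
have [k2 [R2 [V2 [M2 [? ? ? ? ?]]]]] := H2 P _ R1 E2 HV1 wR1 wM1.
exists (k1 + k2), R2, V2, M2; split => //; first by lia.
by rewrite addnA; apply: steps_trans H1 _.
Qed.

Lemma step_jump P b t l R M : onth P b = Some (jump t l) ->
  step w m P (State b R M) =
    Some (State (if test t (R nvar) (R nvar.+1) then l else b.+1) R M).
Proof. by rewrite /step => ->; case: t. Qed.

Lemma step_jmp P b l R M : onth P b = Some (Jmp l) ->
  step w m P (State b R M) = Some (State l R M).
Proof. by rewrite /step => ->. Qed.

Lemma runs_asg r e V M (Q : (nat -> nat) -> (nat -> nat) ->
  Prop) : r < nvar -> safe V M e ->
  Q (upd V r (eval V M e)) M -> runs (csize (Asg r e)) (Asg r e) V M Q.
Proof.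
move=> Hr S HQ P b R /= /embedded_cat[E1 /embedded_cons[E2 _]] HV wR wM.
have [R1 [H1 v1 f1 w1]] := cexp_correct S wM E1 (leqnn _) HV wR.
exists (size (cexp nvar e)).+1, (upd R1 r (R1 nvar)), (upd V r (eval V M e)), M.
split => //.
- rewrite -addn1; apply: steps_trans H1 _ => /=; rewrite E2 /=.
  by rewrite /eval_op PeanoNat.Nat.lor_diag modn_small // addnA addn1.
- by move=> r' Hr'; rewrite /upd v1; case: ifP => // _; rewrite f1 ?HV.
- exact: words_upd.
Qed.

Lemma runs_sto e1 e2 V M (Q : (nat -> nat) -> (nat -> nat) ->
  Prop) : safe V M e1 -> safe V M e2 ->
  eval V M e1 < m -> Q V (upd M (eval V M e1) (eval V M e2)) ->
  runs (csize (Sto e1 e2)) (Sto e1 e2) V M Q.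
Proof.
move=> S1 S2 Hm HQ P b R /= /embedded_cat[E1 /embedded_cons[E2 _]] HV wR wM.
have [R1 [H1 v1 v2 f1 w1]] := cexp2_correct S1 S2 wM E1 HV wR.
exists (size (cexp2 e1 e2)).+1, R1, V, (upd M (eval V M e1) (eval V M e2)).
split => //; last by split=> //; apply: words_upd => //; rewrite -v2.
rewrite -addn1; apply: steps_trans H1 _ => /=.
by rewrite E2 v1 v2 Hm /= addnA addn1.
Qed.

Lemma runs_if t1 t2 t e1 e2 c1 c2 V M Q : safe V M e1 -> safe V M e2 ->
  (test t (eval V M e1) (eval V M e2) -> runs t1 c1 V M Q) ->
  (~~ test t (eval V M e1) (eval V M e2) -> runs t2 c2 V M Q) ->
  runs (size (cexp2 e1 e2) + 2 + maxn t1 t2) (If t e1 e2 c1 c2) V M Q.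
Proof.
move=> S1 S2 Q1 Q2 P b R /= /embedded_cat[E1 /embedded_cons[E2]].
move=> /embedded_cat[]; rewrite size_compile => E3 /embedded_cons[E4 E5] HV wR wM.
have [R1 [H1 v1 v2 f1 w1]] := cexp2_correct S1 S2 wM E1 HV wR.
have H2 := step_jump R1 M E2; rewrite v1 v2 in H2.
have [B|B] := boolP (test t (eval V M e1) (eval V M e2)).
  rewrite B in H2.
  have [k [R2 [V2 [M2 [? H3 ? ? ?]]]]] := Q1 B P _ R1 E5 f1 w1 wM.
  exists (size (cexp2 e1 e2) + k.+1), R2, V2, M2; split => //; first by lia.
  apply: steps_trans H1 _; rewrite (stepsS _ H2) H3;
    congr (Some (State _ _ _)); lia.
rewrite (negPf B) in H2.
have [k [R2 [V2 [M2 [? H3 ? ? ?]]]]] := Q2 B P _ R1 E3 f1 w1 wM.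
exists (size (cexp2 e1 e2) + (k + 1).+1), R2, V2, M2; split => //; first by lia.
apply: steps_trans H1 _; rewrite (stepsS _ H2).
apply: steps_trans H3 _; rewrite (stepsS _ (step_jmp _ _ E4)).
congr (Some (State _ _ _)); lia.
Qed.

(** The variant [f] bounds the number of passes. The 2 in [tc] pays for two jumps: the conditional
    one, and either the jump back or the exit. *)
Lemma runs_while t tb e1 e2 c (I : (nat -> nat) -> (nat -> nat) -> Prop)
    (f : (nat -> nat) -> nat) V M :
  let tc := size (cexp2 e1 e2) + 2 in
  I V M ->
  (forall V M, I V M -> safe V M e1 /\ safe V M e2) ->
  (forall V M, I V M -> test t (eval V M e1) (eval V M e2) ->
     runs tb c V M (fun V' M' => I V' M' /\ f V' < f V)) ->
  runs (f V * (tc + tb) + tc) (While t e1 e2 c) V M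
    (fun V' M' => I V' M' /\ ~~ test t (eval V' M' e1) (eval V' M' e2)).
Proof.
move=> tc HI HS HB; have [u Hu] := ubnP (f V).
elim: u => // u IH in V M HI Hu *.
move=> P b R EE HV wR wM; move: (EE) => /= /embedded_cat[E1 /embedded_cons[E2]].
move=> /embedded_cons[E3 /embedded_cat[E4]]; rewrite size_compile =>
  /embedded_cons[E5 _].
have [S1 S2] := HS V M HI.
have [R1 [H1 v1 v2 f1 w1]] := cexp2_correct S1 S2 wM E1 HV wR.
have H2 := step_jump R1 M E2; rewrite v1 v2 in H2.
have [B|B] := boolP (test t (eval V M e1) (eval V M e2)); last first.
  rewrite (negPf B) in H2.
  exists (size (cexp2 e1 e2) + 2), R1, V, M; split => //; first by rewrite /tc; lia.
  apply: steps_trans H1 _; rewrite (stepsS _ H2) (stepsS _ (step_jmp _ _ E3)).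
  congr (Some (State _ _ _)); lia.
rewrite B in H2.
have [k1 [R2 [V2 [M2 [K1 H3 HV2 wR2 [wM2 [I2 Hf]]]]]]] := HB V M HI B P _ R1 E4
  f1 w1 wM.
have Hu2 : f V2 < u by lia.
have [k2 [R3 [V3 [M3 [K2 H4 ? ? ?]]]]] := IH V2 M2 I2 Hu2 P b R2 EE HV2 wR2 wM2.
exists (size (cexp2 e1 e2) + (k1 + k2.+1).+1), R3, V3, M3; split => //.
  have : (f V2).+1 * (tc + tb) <= f V * (tc + tb) by rewrite leq_mul2r Hf orbT.
  by rewrite mulSn /tc in K2 *; lia.
apply: steps_trans H1 _; rewrite (stepsS _ H2).
by apply: steps_trans H3 _; rewrite (stepsS _ (step_jmp _ _ E5)).
Qed.

(** Meant for loop-free code, hence [False] on [While]; loops go through [runs_while] with an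
    explicit invariant. *)
Fixpoint wp (c : cmd) (Q : (nat -> nat) -> (nat -> nat) -> Prop)
    (V M : nat -> nat) : Prop :=
  match c with
  | Asg r e => [/\ r < nvar, safe V M e & Q (upd V r (eval V M e)) M]
  | Sto e1 e2 =>
      [/\ safe V M e1, safe V M e2, eval V M e1 < m
        & Q V (upd M (eval V M e1) (eval V M e2))]
  | Seq c1 c2 => wp c1 (wp c2 Q) V M
  | If t e1 e2 c1 c2 =>
      [/\ safe V M e1, safe V M e2
        & if test t (eval V M e1) (eval V M e2) then wp c1 Q V M
          else wp c2 Q V M]
  | While _ _ _ _ => False
  end.

(* Without loops every instruction is executed at most once. *)
Lemma runs_wp c Q V M : wp c Q V M -> runs (csize c) c V M Q.
Proof.
elim: c Q V M => [r e|e1 e2|c1 IH1 c2 IH2|t e1 e2 c1 IH1 c2 IH2|//] Q V M /=.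
- by case=> *; apply: runs_asg.
- by case=> *; apply: runs_sto.
- move=> H; apply: runs_seq; apply: runs_weaken (IH1 _ _ _ H) (leqnn _) _.
  by move=> V' M'; apply: IH2.
- case=> S1 S2 H.
  apply: (@runs_weaken (size (cexp2 e1 e2) + 2 + maxn (csize c1) (csize c2)));
    [|lia|by move=> ? ?; exact].
  by apply: runs_if => // B; [apply: IH1; rewrite B in H | apply: IH2;
    rewrite (negPf B) in H].
Qed.

End Machine.


(** * The inversion algorithm on codes *)

Definition nzeros (F : seq bool) (l : nat) : nat := count id (take l F).

(* Position of the k-th true of F, counting from k = 1. *)
Definition zero_pos (F : seq bool) (k : nat) : nat :=
  find (fun i => nzeros F i.+1 == k) (iota 0 (size F)).

Section Algorithm.

Variables (n : nat) (L : seq nat).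

(* Y: codes of the known suffix u; F: positions of 0 in <u>; K: for every row
   the key of its comparison with <u>, which is 3 l + class (class 0, 1, 2 for a
   static symbol, 0, a positive integer in the row) if the row is smaller and
   first differs at l, 3 n if <u> is a prefix of the row, and 4 n - l if the row
   is larger; N: number of parameter symbols in u. *)
Record alg := Alg { aY : seq nat; aF : seq bool; aK : seq nat; aN : nat }.

Definition next_code (K : seq nat) := nth 0 L (index (3 * n) K).

(** An odd code comes from an integer entry of [L], which says at which zero of its row the symbol
    first occurs. An entry exceeding the zeros of the suffix means that the symbol is not there yet,
    and [n] stands for no occurrence. *)
Definition first_occ (F : seq bool) (y : nat) : nat :=
  if y %% 2 == 1 then
    if nzeros F (size F) < y %/ 2 then n else zero_pos F (y %/ 2)
  else n.

(** The same mismatch seen one position further right. *)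
Definition shift_key (k : nat) := if k < 3 * n then k + 3 else k - 1.

(** Here [a] and [b] are the positions of the zeros rewritten in the row and in the suffix, and [a]
    is replaced by [n] unless it lies before the old mismatch [l]. If [a] and [b] differ, whichever
    comes first, before [l], becomes the new mismatch; otherwise the old one survives, possibly with
    its sides exchanged. All positions move by one because of the new front symbol. *)
Definition new_key_param (F : seq bool) (b k h : nat) : nat :=
  let l := if k < 3 * n then k %/ 3 else 4 * n - k in
  let a := if nzeros F l < h then n else zero_pos F h in
  if a < l then
    if a == b then shift_key k
    else if a < b then 4 * n - (a + 1) else 3 * (b + 1) + 1
  else if b < l then 3 * (b + 1) + 1
  else if k < 3 * n then
    if (k %% 3 == 1) && (h == nzeros F l + 1) then 4 * n - (l + 1) else k + 3
  else if b == l then 3 * (l + 1) + 2 else k - 1.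

(** Unless both symbols are parameters or both are the same static symbol, the new encodings differ
    at position 0, which gives the extreme keys 0 (static, smaller) and [4 * n]. *)
Definition new_key (F : seq bool) (y k x : nat) : nat :=
  if k == 3 * n then 3 * n
  else if x %% 2 == 1 then
    if y %% 2 == 1 then new_key_param F (first_occ F y) k (x %/ 2) else 4 * n
  else if x == y then shift_key k
  else if y %% 2 == 1 then 0
  else if x < y then 0 else 4 * n.

Definition new_keys (F : seq bool) (K : seq nat) : seq nat :=
  [seq new_key F (next_code K) p.1 p.2 | p <- zip K L].

Definition alg_next (s : alg) : alg :=
  let: Alg Y F K N := s in
  let y := next_code K in
  let b := first_occ F y in
  let K' := sort leq (new_keys F K) in
  if y %% 2 == 1 then
    if b < n then Alg (nth 0 Y b :: Y) (true :: set_nth false F b false) K' N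
    else Alg (2 * N + 1 :: Y) (true :: F) K' (N + 1)
  else Alg (y :: Y) (false :: F) K' N.

Definition alg_init : alg :=
  Alg [:: 0] [:: false] (3 * n :: nseq n.-1 (4 * n)) 0.

Definition alg_at (m : nat) : alg := iter m.-1 alg_next alg_init.

Definition valid_key (m k : nat) : bool :=
  [|| k == 3 * n, k < 3 * m | (4 * n < k + m) && (k <= 4 * n)].

Definition valid_keys (m : nat) (K : seq nat) : Prop :=
  [/\ size K = n, 3 * n \in K, all (valid_key m) K
    & forall j, nth 0 K j = 3 * n -> j = index (3 * n) K].

End Algorithm.

(** * Counting and locating zeros *)

Lemma leq_nzeros F i j : i <= j -> nzeros F i <= nzeros F j.
Proof.
move=> Hij; rewrite /nzeros -(subnKC Hij) takeD count_cat; exact: leq_addr.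
Qed.

Lemma nzerosS F i : i < size F -> nzeros F i.+1 = nzeros F i + nth false F i.
Proof. by move=> Hi; rewrite /nzeros (take_nth false Hi) -cats1 count_cat /=
  addn0. Qed.

Lemma nzeros_le F i : nzeros F i <= i.
Proof.
rewrite /nzeros; apply: leq_trans (count_size _ _) _.
by rewrite size_take; case: ltnP.
Qed.

Lemma zero_pos_le F k : zero_pos F k <= size F.
Proof. by apply: leq_trans (find_size _ _) _; rewrite size_iota. Qed.

Lemma zero_posE F i : i < size F -> nth false F i ->
  zero_pos F (nzeros F i).+1 = i.
Proof.
move=> Hi Fi; rewrite /zero_pos -(subnKC (ltnW Hi)) iotaD find_cat add0n.
have [/hasP[j]|_] := boolP (has _ _).
  rewrite mem_iota add0n => /andP[_ Hj] /eqP E.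
  by have := leq_nzeros F Hj; rewrite E ltnn.
have -> : size F - i = (size F - i.+1).+1 by lia.
by rewrite /= size_iota nzerosS // Fi addn1 eqxx addn0.
Qed.

Lemma zero_pos_lt F k : 0 < k <= nzeros F (size F) -> zero_pos F k < size F.
Proof.
move=> /andP[k0 Hk]; rewrite /zero_pos -[X in _ < X](size_iota 0) -has_find.
suff H j : j <= size F -> k <= nzeros F j -> exists2 i, i < j & nzeros F i.+1 = k.
  by have [i Hi Ei] := H _ (leqnn _) Hk; apply/hasP; exists i;
    rewrite ?mem_iota ?Ei.
elim: j => [|j IH] Hj; first by rewrite /nzeros take0 leqNgt k0.
have [Hk'|Hk'] := leqP k (nzeros F j).
  by have [i ? ?] := IH (ltnW Hj) Hk'; exists i => //; exact: leqW.
by move=> Hk1; exists j => //; move: Hk1; rewrite nzerosS //;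
  case: (nth _ _ _); lia.
Qed.

(** Keys index the histogram, so this bound keeps the accesses inside its [4 n + 1] cells. *)
Lemma new_key_le n F y k x m : m < n -> valid_key n m k ->
  new_key n F y k x <= 4 * n.
Proof.
move=> Hm; rewrite /valid_key /new_key; case: eqP => /= [_ _|Hk Vk]; first by lia.
have Hs : shift_key n k <= 4 * n by rewrite /shift_key; case: ifP; lia.
case: ifP => _; last by do !case: ifP => //; lia.
case: ifP => // _; rewrite /new_key_param.
set l := (X in nzeros F X); have Hl : l < m by rewrite /l; case: ifP; lia.
set a := (X in X < l); do !(case: ifP => // ?); lia.
Qed.


(** * The inversion program *)

Declare Scope exp_scope.
Delimit Scope exp_scope with X.
Bind Scope exp_scope with exp.
Notation "# k" := (Cst k) (at level 1, format "# k") : exp_scope.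
Notation "$ r" := (Var r) (at level 1, format "$ r") : exp_scope.
Notation "e1 + e2" := (Bin OpAdd e1 e2) : exp_scope.
Notation "e1 - e2" := (Bin OpSub e1 e2) : exp_scope.
Notation "e1 * e2" := (Bin OpMul e1 e2) : exp_scope.
Notation "e1 %/ e2" := (Bin OpDiv e1 e2) : exp_scope.
Notation "e1 %% e2" := (Bin OpMod e1 e2) : exp_scope.
Notation "r ::= e" := (Asg r e%X) (at level 70).
Notation "c1 ;; c2" := (Seq c1 c2) (at level 80, right associativity).

(* Variable 0 holds n, and the array [k] starts at address [k * n]: 0 is the
   input, 1 the recovered text, 2 the flags F, 3 and 4 the functions nzeros and
   zero_pos, 5 the keys K, 6 (of length 4 n + 1) the histogram of the new keys.
   Variables: 1 length of the known suffix, 2 code of the next symbol, 3 loop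
   counter, 4 zero counter, 5 key, 6 input code, 7 new key, 8 l, 9 number of
   parameter symbols, 10 first occurrence b of the next symbol, 11 a. *)
Definition cell (k : nat) (e : exp) : exp := (#k * $0 + e)%X.

Definition For (e : exp) (c : cmd) : cmd :=
  3 ::= #0 ;; While true (Var 3) e (c ;; 3 ::= $3 + #1).

(** The assignment of variable 2 to itself is an empty branch. *)
Definition c_sym : cmd :=
  If false (Deref (cell 5 (Var 3))) (#3 * $0)%X (2 ::= Deref $3) (2 ::= $2).

(** No test for a zero is made: the entry for the next zero is overwritten at every position, and it
    becomes final when a zero is met and the counter moves on. *)
Definition c_zeros : cmd :=
  Sto (cell 3 (Var 3)) (Var 4) ;;
  Sto (cell 4 ($4 + #1)%X) (Var 3) ;;
  4 ::= $4 + Deref (cell 2 ($0 - $1 + $3)).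

Definition c_first : cmd :=
  If false ($2 %% #2)%X (Cst 1)
    (If true (Var 4) ($2 %/ #2)%X (10 ::= $0) (10 ::= Deref (cell 4 ($2 %/ #2))))
    (10 ::= $0).

Definition c_shift : cmd :=
  If true (Var 5) (#3 * $0)%X (7 ::= $5 + #3) (7 ::= $5 - #1).

Definition c_key_param : cmd :=
  If true (Var 5) (#3 * $0)%X (8 ::= $5 %/ #3) (8 ::= #4 * $0 - $5) ;;
  If true (Deref (cell 3 (Var 8))) ($6 %/ #2)%X
    (11 ::= $0) (11 ::= Deref (cell 4 ($6 %/ #2))) ;;
  If true (Var 11) (Var 8)
    (If false (Var 11) (Var 10) c_shift
       (If true (Var 11) (Var 10)
          (7 ::= #4 * $0 - ($11 + #1)) (7 ::= #3 * ($10 + #1) + #1)))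
    (If true (Var 10) (Var 8) (7 ::= #3 * ($10 + #1) + #1)
       (If true (Var 5) (#3 * $0)%X
          (If false ($5 %% #3)%X (Cst 1)
             (If false ($6 %/ #2)%X (Deref (cell 3 (Var 8)) + #1)%X
                (7 ::= #4 * $0 - ($8 + #1)) (7 ::= $5 + #3))
             (7 ::= $5 + #3))
          (If false (Var 10) (Var 8)
             (7 ::= #3 * ($8 + #1) + #2) (7 ::= $5 - #1)))).

Definition c_key : cmd :=
  If false (Var 5) (#3 * $0)%X (7 ::= #3 * $0)
    (If false ($6 %% #2)%X (Cst 1)
       (If false ($2 %% #2)%X (Cst 1) c_key_param (7 ::= #4 * $0))
       (If false (Var 6) (Var 2) c_shift
          (If false ($2 %% #2)%X (Cst 1) (7 ::= #0)
             (If true (Var 6) (Var 2) (7 ::= #0) (7 ::= #4 * $0))))).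

Definition c_count : cmd :=
  5 ::= Deref (cell 5 $3) ;;
  6 ::= Deref $3 ;;
  c_key ;;
  Sto (cell 6 (Var 7)) (Deref (cell 6 (Var 7)) + #1)%X.

(** One pass either advances the candidate key or emits one copy of it. Decrementing the cells
    leaves the histogram empty again for the next round. *)
Definition c_expand : cmd :=
  If false (Deref (cell 6 (Var 5))) (Cst 0)
    (5 ::= $5 + #1)
    (Sto (cell 5 (Var 3)) (Var 5) ;;
     Sto (cell 6 (Var 5)) (Deref (cell 6 (Var 5)) - #1)%X ;;
     3 ::= $3 + #1).

(** The text and the flags are right-aligned in their arrays, so prepending takes constant time. A
    parameter symbol at the front is always a 0, and its former first occurrence, if any, stops
    being one. *)
Definition c_prepend : cmd :=
  If false ($2 %% #2)%X (Cst 1)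
    (Sto (cell 2 ($0 - $1 - #1)%X) (Cst 1) ;;
     If true (Var 10) (Var 0)
       (Sto (cell 1 ($0 - $1 - #1)%X) (Deref (cell 1 ($0 - $1 + $10))) ;;
        Sto (cell 2 ($0 - $1 + $10)%X) (Cst 0))
       (Sto (cell 1 ($0 - $1 - #1)%X) (#2 * $9 + #1)%X ;;
        9 ::= $9 + #1))
    (Sto (cell 1 ($0 - $1 - #1)%X) (Var 2) ;;
     Sto (cell 2 ($0 - $1 - #1)%X) (Cst 0)) ;;
  1 ::= $1 + #1.

Definition c_round : cmd :=
  For (Var 0) c_sym ;;
  (4 ::= #0 ;; For (Var 1) c_zeros) ;;
  c_first ;;
  For (Var 0) c_count ;;
  (3 ::= #0 ;; 5 ::= #0 ;; While true (Var 3) (Var 0) c_expand) ;;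
  c_prepend.

Definition c_fill : cmd := Sto (cell 5 (Var 3)) (#4 * $0)%X.

Definition c_copy : cmd := Sto (Var 3) (Deref (cell 1 (Var 3))).

Definition c_init : cmd :=
  For (Var 0) c_fill ;;
  Sto (cell 5 (Cst 0)) (#3 * $0)%X ;;
  1 ::= #1.

Definition c_main : cmd :=
  c_init ;;
  While true (Var 1) (Var 0) c_round ;;
  For (Var 0) c_copy.

Definition pbwt_inverse : program := compile 0 c_main ++ [:: Halt].

(** The leading 2 sets the counter to 0, the 4 increments it, and the other two 2s are the jumps
    counted in [runs_while]. *)
Definition for_time (u : nat) (e : exp) (c : cmd) : nat :=
  2 + (u * (size (cexp2 (Var 3) e) + 2 + (csize c + 4))
       + (size (cexp2 (Var 3) e) + 2)).

Ltac arith := by repeat (split=> //); lia.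

(** * Verification of the program against the algorithm on codes *)

Section Correctness.

Variables (w mm n : nat) (L : seq nat).
(** The last array ends at address [10 * n], so [11 * n] words of memory suffice. The word bound
    lets addresses and keys be computed without overflow. Code 1, excluded from [L] below, would be
    the integer 0. *)
Hypotheses (n_gt0 : 0 < n) (Hmm : 11 * n <= mm) (Hw : 12 * n <= 2 ^ w).
Hypotheses (sizeL : size L = n) (L_ne1 : 1 \notin L).

(** The body must preserve the counter, variable 3; the invariant for [i.+1] is stated after the
    increment. *)
Lemma runs_for e c u (I : nat -> (nat -> nat) -> (nat -> nat) -> Prop) V M :
  u <= n -> I 0 (upd V 3 0) M ->
  (forall V M i, I i V M -> safe w mm V M e /\ eval V M e = u) ->
  (forall V M i, i < u -> V 3 = i -> I i V M ->
     wp w mm c (fun V' M' => V' 3 = i /\ I i.+1 (upd V' 3 i.+1) M') V M) ->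
  runs w mm (for_time u e c) (For e c) V M
    (fun V' M' => V' 3 = u /\ I u V' M').
Proof.
move=> Hu I0 He Hc; apply: runs_seq; apply: runs_wp => /=; split => //.
  by rewrite expn_gt0.
pose J V M := V 3 <= u /\ I (V 3) V M.
have := @runs_while w mm true (csize c + 4) (Var 3) e (c ;; 3 ::= $3 + #1) J
  (fun V => u - V 3) (upd V 3 0) M.
move=> H; apply: runs_weaken (H _ _ _) _ _; clear H.
- by split.
- by move=> V1 M1 [_ /He[]].
- move=> V1 M1 [Hi HI] /=; have [_ ->] := He _ _ _ HI => lt_i.
  apply: runs_seq; apply: runs_weaken (runs_wp (Hc _ _ _ lt_i erefl HI)) (leqnn
    _) _.
  move=> V2 M2 [E HI2]; apply: runs_wp; split=> //=.
    by split=> //; rewrite ?E; lia.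
  by rewrite E addn1 /J {1 3}/upd /= /upd /= -/(upd V2 3 (V1 3).+1); split;
    [split|lia].
- by rewrite {1}/upd subn0.
- move=> V1 M1 [[Hi HI]] /=; have [_ ->] := He _ _ _ HI => ge_i.
  by have E : V1 3 = u by [lia]; rewrite E in HI *.
Qed.

Lemma wp_seq c1 c2 Q V M :
  wp w mm (c1 ;; c2) Q V M = wp w mm c1 (wp w mm c2 Q) V M.
Proof. by []. Qed.

Lemma wp_if t e1 e2 c1 c2 Q V M :
  safe w mm V M e1 -> safe w mm V M e2 ->
  (test t (eval V M e1) (eval V M e2) -> wp w mm c1 Q V M) ->
  (~~ test t (eval V M e1) (eval V M e2) -> wp w mm c2 Q V M) ->
  wp w mm (If t e1 e2 c1 c2) Q V M.
Proof. by move=> S1 S2 H1 H2 /=; split=> //; case: ifP => [/H1|/negbT/H2]. Qed.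

Definition same_vars (s : seq nat) (V V' : nat -> nat) : Prop :=
  forall r, r \notin s -> V' r = V r.

Definition same_mem (lo hi : nat) (M M' : nat -> nat) : Prop :=
  forall a, (a < lo) || (hi <= a) -> M' a = M a.

Definition array (M : nat -> nat) (b : nat) (s : seq nat) : Prop :=
  forall j, j < size s -> M (b + j) = nth 0 s j.

Lemma array_same M M' lo hi b s : same_mem lo hi M M' ->
  (b + size s <= lo) || (hi <= b) -> array M b s -> array M' b s.
Proof. by move=> SM H A j Hj; rewrite SM ?A //; lia. Qed.

Lemma same_vars_upd s V V' r v : r \in s -> same_vars s V V' ->
  same_vars s V (upd V' r v).
Proof.
move=> Hr SV r' Hr'; rewrite /upd; case: eqP => [E|_]; last exact: SV.
by rewrite E Hr in Hr'.
Qed.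

Lemma same_mem_upd lo hi M M' a v : lo <= a < hi -> same_mem lo hi M M' ->
  same_mem lo hi M (upd M' a v).
Proof.
by move=> Ha SM a' Ha'; rewrite /upd; case: eqP => [E|_]; [lia | exact: SM].
Qed.

Definition histogram (M : nat -> nat) (s : seq nat) : Prop :=
  forall k, k <= 4 * n -> M (6 * n + k) = count_mem k s.

Definition round_time : nat :=
  for_time n (Var 0) c_sym + (2 + for_time n (Var 1) c_zeros +
    (csize c_first + (for_time n (Var 0) c_count +
    (4 + ((5 * n + 1) * (4 + csize c_expand) + 4) + csize c_prepend)))).

Definition alg_inv (m : nat) (s : alg) (V M : nat -> nat) : Prop :=
  [/\ V 0 = n, V 1 = m & V 9 = aN s] /\
  [/\ array M 0 L, array M (n + (n - m)) (aY s),
      array M (2 * n + (n - m)) (map nat_of_bool (aF s)),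
      array M (5 * n) (aK s) & histogram M [::]].

Section Round.

Variables (m : nat) (Y : seq nat) (F : seq bool) (K : seq nat) (N : nat).
Hypotheses (m_gt0 : 0 < m) (m_lt : m < n).
Hypotheses (sizeY : size Y = m) (sizeF : size F = m) (leN : N <= m).
Hypothesis HK : valid_keys n m K.

Let sizeK : size K = n. Proof. by case: HK. Qed.
Let idxK : index (3 * n) K < n.
Proof. by case: HK => <- H _; rewrite index_mem. Qed.


(** The scan does not stop at the hit; variable 2 keeps its value because [valid_keys] allows the
    key [3 * n] only once. *)
Lemma sym_phase V M : V 0 = n -> array M 0 L -> array M (5 * n) K ->
  runs w mm (for_time n (Var 0) c_sym) (For (Var 0) c_sym) V M
    (fun V' M' => [/\ M' = M, V' 2 = next_code n L K & same_vars [:: 2; 3] V V']).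
Proof.
move=> V0 AL AK.
pose I i V' M' := [/\ M' = M, same_vars [:: 2; 3] V V'
  & index (3 * n) K < i -> V' 2 = next_code n L K].
apply: runs_weaken (@runs_for (Var 0) c_sym n I V M _ _ _ _) _ _ => //=.
- by split=> //; apply: same_vars_upd.
- by move=> V1 M1 i [_ sv _]; rewrite sv.
- move=> V1 M1 i Hi Ei [-> sv HI]; have e0 : V1 0 = n by rewrite sv.
  have sv' x : same_vars [:: 2; 3] V (upd (upd V1 2 x) 3 i.+1).
    by do 2!apply: same_vars_upd => //.
  rewrite e0 Ei AK ?sizeK //; split; [arith..|].
  have [_ _ _ uK] := HK.
  case: eqP => /= [EK|NK]; split=> //; first by arith.
    split; first by rewrite /upd /= Ei.
    split=> // _; rewrite /upd /= /next_code -(uK i EK).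
    by apply: (AL i); rewrite sizeL.
  split; first by rewrite /upd /= Ei.
  split=> // Hj; rewrite /upd /=; apply: HI.
  have : index (3 * n) K != i; last by lia.
  by apply: contra_notN NK => /eqP <-; rewrite nth_index //; case: HK.
- by move=> V1 M1 [_ [-> sv ->]].
Qed.

Definition zero_tables (i : nat) (M : nat -> nat) : Prop :=
  (forall l, l < i -> M (3 * n + l) = nzeros F l) /\
  (forall k, 0 < k <= nzeros F i -> M (4 * n + k) = zero_pos F k).

Lemma zeros_phase V M : V 0 = n -> V 1 = m ->
  array M (2 * n + (n - m)) (map nat_of_bool F) ->
  runs w mm (2 + for_time m (Var 1) c_zeros) (4 ::= #0 ;; For (Var 1) c_zeros) V M
    (fun V' M' => [/\ same_vars [:: 3; 4] V V', same_mem (3 * n) (5 * n) M M',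
                      V' 4 = nzeros F m & zero_tables m M']).
Proof.
move=> V0 V1 AF.
pose I i V' M' := [/\ same_vars [:: 3; 4] V V', same_mem (3 * n) (5 * n) M M',
  V' 4 = nzeros F i & zero_tables i M'].
apply: runs_seq; apply: runs_wp => /=; split=> //; first by rewrite expn_gt0.
apply: runs_weaken (@runs_for (Var 1) c_zeros m I _ M _ _ _ _) _ _ => //=.
- exact: ltnW.
- split=> //; first by do 2!apply: same_vars_upd => //.
    by rewrite /upd /= /nzeros take0.
  by split=> // k; rewrite /nzeros take0 /=; lia.
- by move=> V2 M2 i [sv _ _ _]; rewrite sv.
- move=> V2 M2 i Hi Ei [sv sm E4 [T3 T4]].
  have e0 : V2 0 = n by rewrite sv.
  have e1 : V2 1 = m by rewrite sv.
  have Hz := nzeros_le F i.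
  rewrite e0 e1 Ei E4; split; [arith..|lia|].
  split; [arith..|lia|].
  set M3 := upd _ _ _.
  have sm3 : same_mem (3 * n) (5 * n) M M3 by do 2!(apply: same_mem_upd; first lia).
  have -> : M3 (2 * n + (n - m + i)) = nth false F i.
    rewrite sm3; last by lia.
    by have := AF i; rewrite size_map sizeF (nth_map false) ?sizeF // addnA => ->.
  have Hf := leq_b1 (nth false F i).
  split=> //; first by arith.
  rewrite {1}/upd /= Ei; split=> //; split=> //.
  + by do 2!apply: same_vars_upd => //.
  + by rewrite /upd /= nzerosS ?sizeF.
  split=> [l Hl|k Hk]; rewrite /M3 /upd.
    case: eqP => [|_]; first by lia.
    by case: eqP => [E|NE]; [congr (nzeros F _); lia | apply: T3; lia].
  case: eqP => [E|NE].
    move: Hk; rewrite nzerosS ?sizeF // => Hk.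
    have -> : k = (nzeros F i).+1 by lia.
    by rewrite zero_posE ?sizeF //; case: (nth _ _ _) Hk => //; lia.
  case: eqP => [|_]; first by lia.
  apply: T4; move: Hk; rewrite nzerosS ?sizeF //; case: (nth _ _ _) => /=; lia.
- by move=> V2 M2 [_ []].
Qed.

(** Keeps lookups in the table of [zero_pos] away from its entry 0, which [c_zeros] never writes. *)
Lemma code_half k : k \in L -> k %% 2 = 1 -> 0 < k %/ 2.
Proof.
by move=> HkL; have : k != 1 by [apply: contraNneq L_ne1 => <-]; lia.
Qed.

Lemma next_code_in : next_code n L K \in L.
Proof. by rewrite mem_nth // sizeL. Qed.

Lemma first_phase V M (Q : (nat -> nat) -> (nat -> nat) -> Prop) :
  V 0 = n -> V 2 = next_code n L K -> V 4 = nzeros F m -> zero_tables m M ->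
  Q (upd V 10 (first_occ n F (next_code n L K))) M -> wp w mm c_first Q V M.
Proof.
move=> V0 V2 V4 [_ T4]; set y := next_code n L K in V2 *; rewrite /first_occ.
rewrite /= V0 V2 V4 sizeF => HQ; split; [arith..|].
have Hy := code_half next_code_in; rewrite -/y in Hy.
have Hz := nzeros_le F m.
case: eqP HQ => [E|NE] //= HQ; split; [arith..|].
case: ltnP HQ => Hlt HQ; split=> //.
  by arith.
by rewrite T4 // Hlt Hy.
Qed.

Lemma shift_wp V M (Q : (nat -> nat) -> (nat -> nat) -> Prop) :
  V 0 = n -> Q (upd V 7 (shift_key n (V 5))) M -> wp w mm c_shift Q V M.
Proof.
move=> V0; rewrite /shift_key /= V0 => HQ; split; [arith..|].
by case: ltnP HQ => ? HQ; split=> //; arith.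
Qed.

Arguments wp : simpl never.

Lemma key_param_wp V M (Q : (nat -> nat) -> (nat -> nat) -> Prop) :
  V 0 = n -> valid_key n m (V 5) -> V 5 <> 3 * n -> 0 < V 6 %/ 2 -> V 10 <= n ->
  zero_tables m M ->
  (forall V', same_vars [:: 7; 8; 11] V V' ->
     V' 7 = new_key_param n F (V 10) (V 5) (V 6 %/ 2) -> Q V' M) ->
  wp w mm c_key_param Q V M.
Proof.
move=> V0 Vk Nk Hh Hb [T3 T4] HQ; rewrite /valid_key in Vk.
pose l := if V 5 < 3 * n then V 5 %/ 3 else 4 * n - V 5.
have Hl : l < m by rewrite /l; case: ifP; lia.
pose a := if nzeros F l < V 6 %/ 2 then n else zero_pos F (V 6 %/ 2).
have Hz := nzeros_le F l; have Hzm := leq_nzeros F (ltnW Hl).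
have Ha : a <= n.
  by rewrite /a; case: ifP => // _; have := zero_pos_le F (V 6 %/ 2); lia.
have S1 Q' : Q' (upd V 8 l) M -> wp w mm (If true (Var 5) (#3 * $0)%X
    (8 ::= $5 %/ #3) (8 ::= #4 * $0 - $5)) Q' V M.
  rewrite /wp /= V0 /l => HQ'; split; [arith..|].
  by case: ltnP HQ' => ? HQ'; split=> //; arith.
have S2 V1 Q' : V1 0 = n -> V1 8 = l -> V1 6 = V 6 -> Q' (upd V1 11 a) M ->
    wp w mm (If true (Deref (cell 3 (Var 8))) ($6 %/ #2)%X
       (11 ::= $0) (11 ::= Deref (cell 4 ($6 %/ #2)))) Q' V1 M.
  rewrite /wp /= => -> -> ->; rewrite /a T3 // => HQ'; split; [arith..|].
  case: ltnP HQ' => Hlt HQ'; split=> //.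
    by arith.
  by rewrite T4 //; lia.
rewrite /c_key_param wp_seq; apply: S1; rewrite wp_seq; apply: S2 => //;
  set V1 := upd _ _ _.
have HQ1 v : v = new_key_param n F (V 10) (V 5) (V 6 %/ 2) -> Q (upd V1 7 v) M.
  by move=> E; apply: HQ => //; do 3!apply: same_vars_upd => //.
have [[e0 e5] [e6 e8] [e10 e11]] : [/\ V1 0 = n /\ V1 5 = V 5, V1 6 = V 6 /\ V1
  8 = l
  & V1 10 = V 10 /\ V1 11 = a] by [].
rewrite /new_key_param -/l -/a in HQ1.
have HS : a < l -> a == V 10 -> wp w mm c_shift Q V1 M.
  by move=> Hal Hab; apply: shift_wp => //; rewrite e5; apply: HQ1; rewrite Hal Hab.
move: V1 e0 e5 e6 e8 e10 e11 HQ1 HS => V1 e0 e5 e6 e8 e10 e11 HQ1 HS.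
apply: wp_if => [//|//| |] /=; rewrite e8 e11 => Hal.
  apply: wp_if => [//|//| |] /=; rewrite e10 e11 => Hab; first exact: HS.
  apply: wp_if => [//|//| |] /=; rewrite e10 e11 => Hab2; split=> //=;
    rewrite ?e0 ?e10 ?e11; try arith; apply: HQ1; rewrite Hal (negPf Hab).
    by rewrite Hab2.
  by rewrite (negPf Hab2).
rewrite (negPf Hal) in HQ1.
apply: wp_if => [//|//| |] /=; rewrite e8 e10 => Hbl.
  by split=> //=; rewrite e10; [arith|apply: HQ1; rewrite Hbl].
rewrite (negPf Hbl) in HQ1.
apply: wp_if => /=; rewrite ?e0 ?e5; [done|arith| |] => Hk.
  rewrite Hk in HQ1.
  apply: wp_if => /=; rewrite ?e5; [arith|arith| |] => Hm.
    rewrite Hm /= in HQ1.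
    apply: wp_if => /=; rewrite ?e0 ?e6 ?e8 ?T3 //; [arith|arith| |] => Hx.
      by rewrite Hx in HQ1; split=> //=; rewrite ?e0 ?e8; [arith|exact: HQ1].
    by rewrite (negPf Hx) in HQ1; split=> //=; rewrite ?e5; [arith|exact: HQ1].
  by rewrite (negPf Hm) in HQ1; split=> //=; rewrite ?e5; [arith|exact: HQ1].
rewrite (negPf Hk) in HQ1.
apply: wp_if => [//|//| |] /=; rewrite e8 e10 => Hbl'.
  by rewrite Hbl' in HQ1; split=> //=; rewrite ?e8; [arith|exact: HQ1].
by rewrite (negPf Hbl') in HQ1; split=> //=; rewrite ?e5; [arith|exact: HQ1].
Qed.

Lemma key_wp V M (Q : (nat -> nat) -> (nat -> nat) -> Prop) :
  V 0 = n -> valid_key n m (V 5) -> V 6 \in L ->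
  V 10 = first_occ n F (V 2) -> zero_tables m M ->
  (forall V', same_vars [:: 7; 8; 11] V V' ->
     V' 7 = new_key n F (V 2) (V 5) (V 6) -> Q V' M) ->
  wp w mm c_key Q V M.
Proof.
move=> V0 Vk HL Eb T HQ; rewrite /new_key in HQ.
have HQ1 v : v = new_key n F (V 2) (V 5) (V 6) -> Q (upd V 7 v) M.
  by move=> E; apply: HQ => //; apply: same_vars_upd.
rewrite /new_key in HQ1.
apply: wp_if => /=; rewrite ?V0; [done|arith| |] => H1.
  by rewrite H1 in HQ1; split=> //=; rewrite ?V0; [arith|exact: HQ1].
rewrite (negPf H1) in HQ HQ1.
apply: wp_if => /=; [arith|arith| |] => H2.
  rewrite H2 in HQ HQ1.
  apply: wp_if => /=; [arith|arith| |] => H3.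
    rewrite H3 in HQ; apply: key_param_wp => //.
    - by apply/eqP.
    - by apply: code_half => //; apply/eqP.
    - rewrite Eb /first_occ; do 2!case: ifP => // _.
      by have := zero_pos_le F (V 2 %/ 2); lia.
    - by rewrite Eb.
  by rewrite (negPf H3) in HQ1; split=> //=; rewrite ?V0; [arith|exact: HQ1].
rewrite (negPf H2) in HQ1.
apply: wp_if => [//|//| |] /= H3.
  by apply: shift_wp => //; apply: HQ1; rewrite H3.
rewrite (negPf H3) in HQ1.
apply: wp_if => /=; [arith|arith| |] => H4.
  by rewrite H4 in HQ1; split=> //=; [arith|exact: HQ1].
rewrite (negPf H4) in HQ1.
apply: wp_if => [//|//| |] /= H5.
  by rewrite H5 in HQ1; split=> //=; [arith|exact: HQ1].
by rewrite (negPf H5) in HQ1; split=> //=; rewrite ?V0; [arith|exact: HQ1].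
Qed.

Let NK := new_keys n L F K.

Let sizeNK : size NK = n.
Proof. by rewrite size_map size_zip sizeK sizeL minnn. Qed.

Let nthNK i : i < n ->
  nth 0 NK i = new_key n F (next_code n L K) (nth 0 K i) (nth 0 L i).
Proof.
move=> Hi; rewrite (nth_map (0, 0)) ?size_zip ?sizeK ?sizeL ?minnn //.
by rewrite nth_zip ?sizeK ?sizeL.
Qed.

Let validK i : i < n -> valid_key n m (nth 0 K i).
Proof. by move=> Hi; case: HK => _ _ /allP H _; apply/H/mem_nth; rewrite sizeK. Qed.

Let NK_le i : i < n -> nth 0 NK i <= 4 * n.
Proof. by move=> Hi; rewrite nthNK //; apply: new_key_le m_lt (validK Hi). Qed.

Lemma count_phase V M : V 0 = n -> V 2 = next_code n L K ->
  V 10 = first_occ n F (next_code n L K) -> array M 0 L -> array M (5 * n) K ->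
  zero_tables m M -> histogram M [::] ->
  runs w mm (for_time n (Var 0) c_count) (For (Var 0) c_count) V M
    (fun V' M' => [/\ same_vars [:: 3; 5; 6; 7; 8; 11] V V',
       same_mem (6 * n) (10 * n + 1) M M' & histogram M' NK]).
Proof.
move=> V0 V2 V10 AL AK [T3 T4] H0.
pose I i V' M' := [/\ same_vars [:: 3; 5; 6; 7; 8; 11] V V',
  same_mem (6 * n) (10 * n + 1) M M' & histogram M' (take i NK)].
apply: runs_weaken (@runs_for (Var 0) c_count n I _ M _ _ _ _) _ _ => //=.
- by split=> //; [apply: same_vars_upd | rewrite take0].
- by move=> V3 M3 i [sv _ _]; rewrite sv.
- move=> V3 M3 i Hi Ei [sv sm H].
  have e0 : V3 0 = n by rewrite sv.
  rewrite /c_count wp_seq; split=> //=; rewrite ?e0 ?Ei; first by arith.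
  rewrite sm; last by lia.
  rewrite AK ?sizeK // wp_seq; split=> //=; first by rewrite {1}/upd /= Ei; arith.
  have -> : M3 (upd V3 5 (nth 0 K i) 3) = nth 0 L i.
    by rewrite /upd /= Ei sm; [apply: (AL i); rewrite sizeL | lia].
  set V4 := upd _ _ _; rewrite wp_seq.
  have sv4 : same_vars [:: 3; 5; 6; 7; 8; 11] V V4.
    by do 2!apply: same_vars_upd => //.
  have e2 : V4 2 = next_code n L K by rewrite /V4 /upd /= sv.
  apply: key_wp => //.
  + exact: validK.
  + by rewrite mem_nth ?sizeL.
  + by rewrite e2 -V10; apply: sv.
  + split=> [l Hl|k Hk]; first by rewrite sm ?T3 //; lia.
    have Hz := nzeros_le F m.
    by rewrite sm ?T4 //; lia.
  rewrite e2 [V4 5]/= [V4 6]/= /V4 /upd /= -nthNK // -/(upd V3 5 _) -/(upd (upd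
    V3 5 _) 6 _) -/V4.
  move=> V5 sv5 e7; have Hk := NK_le Hi.
  have f0 : V5 0 = n by rewrite sv5.
  have f3 : V5 3 = i by rewrite sv5.
  have Hc : count_mem (nth 0 NK i) (take i NK) <= i.
    by apply: leq_trans (count_size _ _) _; rewrite size_take; case: ifP; lia.
  split=> //=; rewrite ?f0 ?e7 ?H //; [arith|arith|lia|].
  rewrite f3; split=> //; split.
  + apply: same_vars_upd => // r Hr; rewrite sv5.
      by apply: sv4.
    by apply: contra Hr; rewrite !inE => /or3P[] ->; rewrite ?orbT.
  + by apply: same_mem_upd => //; lia.
  move=> k Hk'; rewrite /upd (take_nth 0) ?sizeNK // -cats1 count_cat /= addn0.
  case: eqP => [E|NE].
    by have -> : k = nth 0 NK i by [lia]; rewrite eqxx.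
  by rewrite H // [_ == k](_ : _ = false) ?addn0 //; lia.
- by move=> V3 M3 [_ [sv sm]]; rewrite -{1}sizeNK take_size.
Qed.

Lemma expand_phase V M : V 0 = n -> histogram M NK ->
  runs w mm (4 + ((5 * n + 1) * (4 + csize c_expand) + 4))
    (3 ::= #0 ;; 5 ::= #0 ;; While true (Var 3) (Var 0) c_expand) V M
    (fun V' M' => [/\ same_vars [:: 3; 5] V V',
       same_mem (5 * n) (10 * n + 1) M M', array M' (5 * n) (sort leq NK)
       & histogram M' [::]]).
Proof.
move=> V0 HH; set S := sort leq NK.
have sizeS : size S = n by rewrite size_sort.
have S_le k i : k \in drop i S -> k <= 4 * n.
  move=> /mem_drop; rewrite mem_sort => /(nthP 0)[j]; rewrite sizeNK => Hj <-.
  exact: NK_le.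
have sS i : sorted leq (drop i S) by apply/drop_sorted/sort_sorted/leq_total.
(* The first [V' 3] sorted keys have been written, the histogram counts exactly the remaining ones,
   and none of these is below the candidate [V' 5]. *)
pose J V' M' := [/\ same_vars [:: 3; 5] V V', same_mem (5 * n) (10 * n + 1) M M',
  V' 3 <= n /\ V' 5 <= 4 * n + 1, forall j, j < V' 3 -> M' (5 * n + j) = nth 0 S j
  & histogram M' (drop (V' 3) S) /\ {in drop (V' 3) S, forall k, V' 5 <= k}].
rewrite (_ : 4 + _ = 2 + (2 + ((5 * n + 1) * (4 + csize c_expand) + 4)));
  last by lia.
apply: runs_seq; apply: runs_wp; split=> //=; first by rewrite expn_gt0.
apply: runs_seq; apply: runs_wp; split=> //=; first by rewrite expn_gt0.
set V1 := upd _ _ _.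
(* The variant starts at [n + (4 * n + 1)], whence the [5 * n + 1] passes: each one fills a slot or
   advances the key. *)
apply: runs_weaken (@runs_while w mm true (csize c_expand) (Var 3) (Var 0)
  c_expand J
  (fun V => (n - V 3) + (4 * n + 1 - V 5)) V1 M _ _ _) _ _.
- split=> //; first by do 2!apply: same_vars_upd => //.
  split; rewrite drop0 // => k Hk; rewrite HH //.
  have /seq.permP EP : perm_eq NK S by rewrite perm_sym perm_sort.
  exact: EP.
- by move=> V2 M2 [].
- move=> V2 M2 [sv sm [H3 H5] HS [Hh Hge]] /=; have -> : V2 0 = n by rewrite sv.
  move=> lt3; apply: runs_wp; have e0 : V2 0 = n by rewrite sv.
  have E := drop_nth 0 (leq_trans lt3 (eq_leq (esym sizeS))).
  set x := nth 0 S (V2 3) in E.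
  have x5 : V2 5 <= x by apply: Hge; rewrite E mem_head.
  have x4 : x <= 4 * n by apply: (S_le _ (V2 3)); rewrite E mem_head.
  have xle : {in drop (V2 3).+1 S, forall k, x <= k}.
    have := sS (V2 3); rewrite E /= => /(order_path_min leq_trans)/allP; exact.
  apply: wp_if => //=; rewrite ?e0; [arith|arith| |]; rewrite Hh; try lia.
    rewrite -leqn0 leqNgt -has_count has_pred1 => Hx.
    split=> //=; first by arith.
    have Nx : V2 5 != x by apply: contraNneq Hx => ->; rewrite E mem_head.
    split; last by rewrite /upd /=; lia.
    split=> //; first by apply: same_vars_upd.
      by rewrite /upd /=; lia.
    split=> //; rewrite /upd /= => k Hk; have := Hge k Hk.
    rewrite leq_eqVlt addn1 => /orP[/eqP Ek|//].
    by rewrite Ek Hk in Hx.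
  rewrite -lt0n -has_count has_pred1 => Hx.
  (* The candidate occurs among the remaining keys and is a lower bound for them, so it is their
     minimum, the next one in sorted order. *)
  have Ex : V2 5 = x.
    by move: Hx; rewrite E inE => /orP[/eqP//|/xle]; lia.
  rewrite Ex; rewrite wp_seq; split=> //=; rewrite ?e0; [arith|lia|].
  rewrite wp_seq; split=> //=; rewrite ?e0 ?Ex; [arith| |lia|].
    split; [arith|lia|].
    rewrite {1}/upd ifF; last by lia.
    by rewrite Hh // E /= eqxx; lia.
  split=> //=; first by arith.
  set M4 := upd _ (6 * n + x) _.
  have E4 a : M4 a = if a == 6 * n + x then count_mem x (drop (V2 3).+1 S)
     else if a == 5 * n + V2 3 then x else M2 a.
    rewrite /M4 /upd; case: eqP => // _; rewrite ifF; last by lia.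
    by rewrite Hh // E /= eqxx; lia.
  split; last by rewrite /upd /=; lia.
  split.
  + by apply: same_vars_upd.
  + by move=> a Ha; rewrite E4 !ifF ?sm //; lia.
  + by rewrite /upd /=; lia.
  + rewrite /upd /= => j Hj; rewrite E4 ifF; last by lia.
    by case: eqP => [Ej|NEj]; [congr nth; lia | apply: HS; lia].
  rewrite /upd /= addn1; split.
    move=> k Hk; rewrite E4; case: eqP => [Ek|NEk];
      first by congr (count_mem _ _); lia.
    rewrite ifF; last by lia.
    by rewrite Hh // E /= [x == k](_ : _ = false) //; lia.
  by move=> k Hk; rewrite Ex; apply: xle.
- by rewrite /= /V1 /upd /=; apply: leq_add => //; rewrite leq_mul2r;
  apply/orP; right; lia.
move=> V2 M2 [[sv sm [H3 H5] HS [Hh Hge]]] /=.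
have -> : V2 0 = n by rewrite sv.
move=> ge3; have E3 : V2 3 = n by lia.
rewrite E3 drop_oversize ?sizeS // in Hh HS; split=> // j; rewrite sizeS; exact: HS.
Qed.

Lemma first_occ_lt : first_occ n F (next_code n L K) < n ->
  [/\ next_code n L K %% 2 = 1 & first_occ n F (next_code n L K) < m].
Proof.
rewrite /first_occ; case: eqP => [E|_]; last by rewrite ltnn.
case: ifP => [|/negbT]; first by rewrite ltnn.
by rewrite -leqNgt => H; split=> //;
  rewrite -sizeF zero_pos_lt // (code_half next_code_in E).
Qed.

Let s' := alg_next n L (Alg Y F K N).

Lemma prepend_wp V M (Q : (nat -> nat) -> (nat -> nat) -> Prop) :
  V 0 = n -> V 1 = m -> V 2 = next_code n L K -> V 9 = N ->
  V 10 = first_occ n F (next_code n L K) ->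
  array M (n + (n - m)) Y -> array M (2 * n + (n - m)) (map nat_of_bool F) ->
  (forall V' M', same_vars [:: 1; 9] V V' -> same_mem n (3 * n) M M' ->
     V' 1 = m.+1 -> V' 9 = aN s' -> array M' (n + (n - m.+1)) (aY s') ->
     array M' (2 * n + (n - m.+1)) (map nat_of_bool (aF s')) -> Q V' M') ->
  wp w mm c_prepend Q V M.
Proof.
move=> V0 V1 V2 V9 V10 AY AF HQ; rewrite /c_prepend wp_seq.
have fin V' M' : same_vars [:: 9] V V' -> same_mem n (3 * n) M M' ->
    V' 9 = aN s' -> array M' (n + (n - m.+1)) (aY s') ->
    array M' (2 * n + (n - m.+1)) (map nat_of_bool (aF s')) ->
    wp w mm (1 ::= $1 + #1) Q V' M'.
  move=> sv sm E9 AY' AF'; have e1 : V' 1 = m by rewrite sv.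
  split=> //=; rewrite e1; first by arith.
  apply: HQ => //; last by rewrite /upd /= addn1.
  apply: same_vars_upd => // r Hr; apply: sv.
  by apply: contra Hr; rewrite !inE => ->; rewrite orbT.
have AYF x y (M' : nat -> nat) Y' F' : size Y' = m -> size F' = m ->
    M' (n + (n - m.+1)) = x -> M' (2 * n + (n - m.+1)) = nat_of_bool y ->
    (forall i, i < m -> M' (n + (n - m) + i) = nth 0 Y' i) ->
    (forall i, i < m -> M' (2 * n + (n - m) + i) = nth false F' i) ->
    array M' (n + (n - m.+1)) (x :: Y') /\
    array M' (2 * n + (n - m.+1)) (map nat_of_bool (y :: F')).
  move=> sY sF Ex Ey EY EF; split=> [] [_|j] /=;
    rewrite ?addn0 // ?sY ?size_map ?sF ltnS => Hj.
    by rewrite -EY //; congr M'; lia.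
  by rewrite (nth_map false) ?sF // -EF //; congr M'; lia.
have {}AY i : i < m -> M (n + (n - m) + i) = nth 0 Y i by move=> Hi;
  rewrite AY ?sizeY.
have {}AF i : i < m -> M (2 * n + (n - m) + i) = nth false F i.
  by move=> Hi; rewrite AF ?size_map ?sizeF // (nth_map false) ?sizeF.
have Hb := first_occ_lt; rewrite /s' /alg_next in fin *.
set y := next_code n L K in V2 V10 fin Hb *;
  set b := first_occ n F y in V10 fin Hb *.
apply: wp_if => /=; rewrite ?V2; [arith|arith| |] => Hy; last first.
  rewrite (negPf Hy) /= in fin.
  rewrite wp_seq; split=> //=; rewrite ?V0 ?V1; [arith|lia|].
  split=> //=; rewrite ?V0 ?V1; [arith|lia|lia|].
  set M' := upd _ (2 * n + _) _.
  have sm : same_mem n (3 * n) M M' by do 2!(apply: same_mem_upd; first by lia).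
  have [||i Hi|i Hi|AY' AF'] := AYF y false M' _ _ sizeY sizeF.
  + by rewrite /M' /upd ifF ?ifT //; lia.
  + by rewrite /M' /upd ifT //; lia.
  + by rewrite /M' /upd !ifF ?AY //; lia.
  + by rewrite /M' /upd !ifF ?AF //; lia.
  exact: fin.
rewrite Hy in fin.
rewrite wp_seq; split=> //=; rewrite ?V0 ?V1; [arith|lia|lia|].
apply: wp_if => //=; rewrite V0 V10 => Hbn.
  rewrite Hbn in fin; have [_ Hbm] := Hb Hbn.
  rewrite wp_seq; split=> //=; rewrite ?V0 ?V1 ?V10; [arith|arith|lia|].
  split=> //=; rewrite ?V0 ?V1 ?V10; [arith|lia|lia|].
  set M' := upd _ (2 * n + (n - m + b)) _.
  have sm : same_mem n (3 * n) M M' by do 3!(apply: same_mem_upd; first by lia).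
  have sF : size (set_nth false F b false) = m by rewrite size_set_nth sizeF; lia.
  have [||i Hi|i Hi|AY' AF'] := AYF (nth 0 Y b) true M' _ _ sizeY sF.
  + rewrite /M' /upd [LHS]ifF; last by lia.
    rewrite [LHS]ifT; last by lia.
    by rewrite ifF; [rewrite -AY //; congr M; lia | lia].
  + rewrite /M' /upd [LHS]ifF; last by lia.
    by rewrite [LHS]ifF ?[LHS]ifT //; lia.
  + by rewrite /M' /upd !ifF ?AY //; lia.
  + rewrite nth_set_nth /= /M' /upd; case: (i =P b) => [->|NE].
      by rewrite ifT //; lia.
    by rewrite !ifF ?AF //; lia.
  exact: fin.
rewrite (negPf Hbn) in fin.
rewrite wp_seq; split=> //=; rewrite ?V0 ?V1 ?V9; [arith|arith|lia|].
split=> //=; rewrite ?V9; [arith|].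
set M' := upd _ (1 * n + _) _.
have sm : same_mem n (3 * n) M M' by do 2!(apply: same_mem_upd; first by lia).
have [||i Hi|i Hi|AY' AF'] := AYF (2 * N + 1) true M' _ _ sizeY sizeF.
- by rewrite /M' /upd ifT //; lia.
- by rewrite /M' /upd ifF ?ifT //; lia.
- by rewrite /M' /upd !ifF ?AY //; lia.
- by rewrite /M' /upd !ifF ?AF //; lia.
by apply: fin => //; apply: same_vars_upd.
Qed.

Lemma round_phase V M : alg_inv m (Alg Y F K N) V M ->
  runs w mm round_time c_round V M (alg_inv m.+1 s').
Proof.
rewrite /alg_inv /= => -[[V0 V1 V9] [AL AY AF AK H0]].
rewrite /round_time; apply: runs_seq;
  apply: runs_weaken (sym_phase V0 AL AK) (leqnn _) _.
move=> Va _ [-> Va2 sva].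
apply: runs_seq; apply: runs_weaken (@zeros_phase Va M _ _ AF) _ _.
- by rewrite sva.
- by rewrite sva.
- by rewrite leq_add2l /for_time !leq_add // leq_mul // ltnW.
move=> Vb Mb [svb smb Vb4 Tb].
apply: runs_seq; apply: runs_wp; apply: (first_phase _ _ _ Tb) => //.
- by rewrite svb ?sva.
- by rewrite svb.
set Vc := upd _ _ _.
have svc : same_vars [:: 10; 3; 4; 2] V Vc.
  apply: same_vars_upd => // r Hr; rewrite svb ?sva //.
    by apply: contra Hr; rewrite !inE => /orP[] ->; rewrite ?orbT.
  by apply: contra Hr; rewrite !inE => /orP[] ->; rewrite ?orbT.
have Vc2 : Vc 2 = next_code n L K by rewrite /Vc /upd /= svb.
apply: runs_seq; apply: runs_weaken (@count_phase Vc Mb _ Vc2 _ _ _ Tb _)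
  (leqnn _) _.
- by rewrite svc.
- by [].
- by apply: array_same smb _ AL; rewrite sizeL; lia.
- by apply: array_same smb _ AK; lia.
- by move=> k Hk; rewrite smb ?H0 //; lia.
move=> Vd Md [svd smd Hd].
apply: runs_seq; apply: runs_weaken (@expand_phase Vd Md _ Hd) (leqnn _) _.
  by rewrite svd ?svc.
move=> Ve Me [sve sme Ae He].
have smc : same_mem (3 * n) (10 * n + 1) M Me.
  by move=> a Ha; rewrite sme ?smd ?smb //; lia.
apply: runs_wp; apply: prepend_wp.
- by rewrite sve ?svd ?svc.
- by rewrite sve ?svd ?svc.
- by rewrite sve ?svd.
- by rewrite sve ?svd ?svc.
- by rewrite sve ?svd.
- by apply: array_same smc _ AY; lia.
- by apply: array_same smc _ AF; rewrite size_map; lia.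
move=> Vf Mf svf smf Vf1 Vf9 AYf AFf.
have Ks : aK s' = sort leq NK by rewrite /s' /=; do 2!case: ifP => //.
split; first by split=> //; rewrite svf ?sve ?svd ?svc.
split=> //.
- apply: array_same smf _ _; first by rewrite sizeL; lia.
  by apply: array_same smc _ AL; rewrite sizeL; lia.
- by rewrite Ks; apply: array_same smf _ Ae; lia.
by move=> k Hk; rewrite smf ?He //; lia.
Qed.

End Round.

(** Memory beyond the input is 0, which already spells the end marker (code 0), its flag and the
    empty histogram; only the keys and the length must be written. *)
Lemma init_phase V M : V 0 = n -> V 9 = 0 -> array M 0 L ->
  (forall a, n <= a -> M a = 0) ->
  runs w mm (for_time n (Var 0) c_fill + (9 + 2)) c_init V M
    (alg_inv 1 (alg_init n)).
Proof.
move=> V0 V9 AL HM.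
pose I i V' M' := [/\ same_vars [:: 3] V V', same_mem (5 * n) (6 * n) M M'
  & forall j, j < i -> M' (5 * n + j) = 4 * n].
apply: runs_seq.
apply: runs_weaken (@runs_for (Var 0) c_fill n I _ M _ _ _ _) (leqnn _) _ => //=.
- by split=> //; apply: same_vars_upd.
- by move=> V1 M1 i [sv _ _]; rewrite sv.
- move=> V1 M1 i Hi Ei [sv sm H]; have e0 : V1 0 = n by rewrite sv.
  split=> //=; rewrite ?e0 ?Ei; [arith|arith|lia|].
  split=> //; split; first by apply: same_vars_upd.
    by apply: same_mem_upd => //; lia.
  by move=> j Hj; rewrite /upd; case: eqP => // NE; apply: H; lia.
move=> V1 M1 [_ [sv sm H]]; have e0 : V1 0 = n by rewrite sv.
apply: runs_seq; apply: runs_wp; split=> //=; rewrite ?e0; [arith|arith|lia|].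
apply: runs_wp; split=> //=; first by lia.
set M2 := upd _ (5 * n + 0) _.
have sm2 : same_mem (5 * n) (6 * n) M M2 by apply: same_mem_upd => //; lia.
split; first by rewrite /upd /= sv // sv.
split.
- by apply: array_same sm2 _ AL; rewrite sizeL; lia.
- by case=> //= _; rewrite sm2 ?HM //; lia.
- by case=> //= _; rewrite sm2 ?HM //; lia.
- move=> [_|j] /=; first by rewrite /M2 /upd eqxx.
  rewrite size_nseq nth_nseq ltnS => Hj; rewrite Hj /M2 /upd ifF; last by lia.
  by apply: H; lia.
- by move=> k Hk; rewrite sm2 ?HM //; lia.
Qed.

(** The only fact about pBWTs, besides [L_ne1], on which the program relies; [alg_at_good] supplies
    it. *)
Hypothesis good_alg : forall m, 0 < m <= n ->
  [/\ size (aY (alg_at n L m)) = m, size (aF (alg_at n L m)) = m,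
      aN (alg_at n L m) <= m & valid_keys n m (aK (alg_at n L m))].

Lemma alg_atS m : 0 < m -> alg_at n L m.+1 = alg_next n L (alg_at n L m).
Proof. by case: m. Qed.

Definition main_time : nat :=
  for_time n (Var 0) c_fill + (9 + 2)
  + (n * (4 + round_time) + 4 + for_time n (Var 0) c_copy).

Lemma main_phase V M : V 0 = n -> V 9 = 0 -> array M 0 L ->
  (forall a, n <= a -> M a = 0) ->
  runs w mm main_time c_main V M (fun V' M' => array M' 0 (aY (alg_at n L n))).
Proof.
move=> V0 V9 AL HM.
apply: runs_seq; apply: runs_weaken (init_phase V0 V9 AL HM) (leqnn _) _.
move=> {V0 V9 AL HM}V {}M HI; apply: runs_seq.
pose J V M := 0 < V 1 <= n /\ alg_inv (V 1) (alg_at n L (V 1)) V M.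
have V1 : V 1 = 1 by case: HI => -[].
apply: runs_weaken (@runs_while w mm true round_time (Var 1) (Var 0) c_round J
  (fun V => n - V 1) V M _ _ _) _ _.
- by split; rewrite V1.
- by move=> ? ? _.
- move=> Va Ma [/andP[Hm _] [[E0 E1 E9] IM]] /=; rewrite E0 => lt_m.
  have [sY sF sN HK] := good_alg (introT andP (conj Hm (ltnW lt_m))).
  move: sY sF sN HK E9 IM (alg_atS Hm); case: (alg_at n L (Va 1)) => Y F K N /=.
  move=> sY sF sN HK E9 IM ES.
  apply: runs_weaken (round_phase Hm lt_m sY sF sN HK (conj (And3 E0 E1 E9)
    IM)) (leqnn _) _.
  move=> Vb Mb [[F0 F1 F9] IMb]; rewrite /J /alg_inv F1 ES.
  by split; [split; [lia | split] | lia].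
- by rewrite leq_add2r leq_mul2r; apply/orP; right; lia.
move=> {HI V1}V {}M [[Hm [[V0 V1 V9] [AL AY _ _ _]]]] /=; rewrite V0 => ge_m.
have E1 : V 1 = n by lia.
have [sY _ _ _] := good_alg (introT andP (conj n_gt0 (leqnn n))).
rewrite E1 subnn addn0 in AY.
pose I i V' M' := [/\ same_vars [:: 3] V V', same_mem 0 n M M'
  & forall j, j < i -> M' j = nth 0 (aY (alg_at n L n)) j].
apply: runs_weaken (@runs_for (Var 0) c_copy n I _ M _ _ _ _) (leqnn _) _ => //=.
- by split=> //; apply: same_vars_upd.
- by move=> Va Ma i [sv _ _]; rewrite sv.
- move=> Va Ma i Hi Ei [sv sm H]; have e0 : Va 0 = n by rewrite sv.
  split=> //=; rewrite ?e0 ?Ei; [arith|lia|].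
  split=> //; split; first by apply: same_vars_upd.
    by apply: same_mem_upd => //; lia.
  move=> j Hj; rewrite /upd; case: eqP => [->|NE]; last by apply: H; lia.
  by rewrite mul1n sm ?AY ?sY //; lia.
by move=> Va Ma [_ [_ _ H]] j; rewrite sY; apply: H.
Qed.

Lemma pbwt_inverse_correct : all (fun x => x < 2 ^ w) L ->
  ram_computes w mm main_time pbwt_inverse L (aY (alg_at n L n)).
Proof.
move=> /allP HL; have [sY _ _ _] := good_alg (introT andP (conj n_gt0 (leqnn n))).
have En : n %% 2 ^ w = n by rewrite modn_small //; lia.
split; [by rewrite sizeL; lia | by rewrite sY; lia |].
set V := upd (fun=> 0) 0 n; set M := fun i => nth 0 L i %% 2 ^ w.
have wV : words w V by move=> i; rewrite /V /upd; case: ifP; lia.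
have wM : words w M by move=> i; rewrite ltn_mod expn_gt0.
have AL : array M 0 L by move=> j Hj; rewrite /M modn_small // HL // mem_nth.
have HM a : n <= a -> M a = 0 by move=> Ha; rewrite /M nth_default ?sizeL // mod0n.
have E : embedded pbwt_inverse 0 (compile 0 c_main).
  by move=> i Hi; rewrite add0n onth_cat Hi.
have [k [R' [V' [M' [Hk Hs _ _ [_ AO]]]]]] :=
  main_phase (erefl : V 0 = n) erefl AL HM E (fun r _ => erefl) wV wM.
exists k, (State (0 + csize c_main) R' M'); split=> //.
  by rewrite /input_state sizeL En.
apply: (@eq_from_nth _ 0); rewrite size_mkseq // => i Hi.
by rewrite nth_mkseq //= AO.
Qed.

End Correctness.

(** As [1 <= n <= n * n], the constant only has to dominate the sum of the coefficients of the
    polynomial [main_time]. *)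
Lemma main_time_le n : 0 < n -> main_time n <= 1000 * n ^ 2.
Proof.
rewrite /main_time /round_time /for_time /= => n0.
by have : n <= n * n by [rewrite leq_pmulr]; rewrite -mulnn; lia.
Qed.


(** * Prev-encodings and keys *)

Section PStrings.

Variables (ds dp : Order.disp_t).
Variables (Ss : finOrderType ds) (Sp : finOrderType dp).

Implicit Types (x y : Ss + nat) (P X Y : seq (Ss + nat)) (w u v : seq (Ss + Sp)).

(** An order embedding of the symbols into [nat], which turns comparisons into arithmetic. *)
Definition symb_rank x : nat :=
  match x with inl a => Order.enum_rank a | inr k => #|Ss| + k end.

Lemma enum_rank_lt (a b : Ss) : (a < b)%O = (Order.enum_rank a < Order.enum_rank b).
Proof. by rewrite Order.TotalTheory.ltNge -(Order.le_enum_rank (@Order.le_total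
  _ Ss)) ltnNge. Qed.

Lemma symb_ltE x y : symb_lt x y = (symb_rank x < symb_rank y).
Proof.
case: x y => [a|k] [b|l] /=; last by rewrite ltn_add2l.
- exact: enum_rank_lt.
- by apply/esym/ltn_addr.
- by apply/esym/negbTE; rewrite -leqNgt; apply/ltnW/ltn_addr.
Qed.

Lemma symb_rank_inj : injective symb_rank.
Proof.
case=> [a|k] [b|l] /=.
- by move/ord_inj/Order.EnumVal.enum_rank_inj => ->.
- by have := ltn_ord (Order.enum_rank a) => /[swap] ->; rewrite ltnNge leq_addr.
- by have := ltn_ord (Order.enum_rank b) => /[swap] <-; rewrite ltnNge leq_addr.
by move/addnI => ->.
Qed.

Lemma lex_le_total : total (@lex_le _ Ss).
Proof.
elim=> [|x X IH] [|y Y] //=; rewrite !symb_ltE [y == x]eq_sym.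
case: (x =P y) => [->|NE] /=; first by rewrite ltnn IH.
by case: ltngtP => // /symb_rank_inj.
Qed.

Definition symb_class x : nat :=
  match x with inl _ => 0 | inr 0 => 1 | inr _.+1 => 2 end.

(** * Keys as a monotone code of the comparison with the known suffix *)

Section Key.

Variable n : nat.

(** Among smaller rows an earlier mismatch means a smaller row, among larger rows a larger one, so
    the codes increase with [l] on one side and decrease on the other. Three classes for each
    position below, the match, and one code for each position above give the range from 0 to
    [4 * n]. *)
Fixpoint key_from (l : nat) P X : nat :=
  match P, X with
  | p :: P', x :: X' =>
      if x == p then key_from l.+1 P' X'
      else if symb_lt x p then 3 * l + symb_class x else 4 * n - l
  | _, _ => 3 * n
  end.

Definition key P X := key_from 0 P X.

Lemma symb_class_le x : symb_class x <= 2.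
Proof. by case: x => // -[]. Qed.

Lemma symb_class_mono x y : symb_lt x y -> symb_class x <= symb_class y.
Proof. by case: x y => [a|[|k]] [b|[|l]]. Qed.

Lemma key_from_bounds l P X : l + size P <= n ->
  3 * l <= key_from l P X <= 4 * n - l.
Proof.
elim: P l X => [|p P IH] l [|x X] /= Hl; try lia.
case: eqP => _; first by have := IH l.+1 X; lia.
by case: ifP => _; have := symb_class_le x; lia.
Qed.

(** At the first difference of [X] and [Y] with [P] not yet left, either one of them still agrees
    with [P], or both leave it here and [symb_class_mono] settles the rows on the smaller side. *)
Lemma key_from_mono l P X Y : size X = size Y -> size P <= size X ->
  l + size P <= n -> lex_le X Y -> key_from l P X <= key_from l P Y.
Proof.
elim: P l X Y => [|p P IH] l [|x X] [|y Y] //= [HXY] HP Hl.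
have Bx := @key_from_bounds l.+1 P X; have By := @key_from_bounds l.+1 P Y.
have Cx := symb_class_le x; have Cy := symb_class_le y.
case/orP => [Hxy|/andP[/eqP <- HL]]; last first.
  by case: eqP => // _; apply: IH => //; lia.
have := symb_class_mono Hxy; move: Hxy; rewrite !symb_ltE.
have [->|Nx] := eqVneq x p.
  have [->|Ny] := eqVneq y p; first by rewrite ltnn.
  by move=> Hpy; rewrite ifF; lia.
have [->|Ny] := eqVneq y p.
  by move=> ->; lia.
have : symb_rank x != symb_rank p by rewrite (inj_eq symb_rank_inj).
have : symb_rank y != symb_rank p by rewrite (inj_eq symb_rank_inj).
by do 2!case: ifP; lia.
Qed.

Notation d := (inr 0 : Ss + nat).

Lemma key_from_lo l P X j : j < size P -> j < size X ->
  (forall i, i < j -> nth d P i = nth d X i) -> symb_lt (nth d X j) (nth d P j) ->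
  key_from l P X = 3 * (l + j) + symb_class (nth d X j).
Proof.
elim: P l X j => [|p P IH] l [|x X] //= [|j] HP HX Heq /= Hlt.
  case: eqP => [E|_]; last by rewrite Hlt addn0.
  by move: Hlt; rewrite E symb_ltE ltnn.
have /= E0 := Heq 0 (ltn0Sn _); rewrite -E0 eqxx (IH _ _ j) ?addnS // => i Hi.
exact: (Heq i.+1).
Qed.

Lemma key_from_hi l P X j : j < size P -> j < size X ->
  (forall i, i < j -> nth d P i = nth d X i) -> symb_lt (nth d P j) (nth d X j) ->
  key_from l P X = 4 * n - (l + j).
Proof.
elim: P l X j => [|p P IH] l [|x X] //= [|j] HP HX Heq /= Hlt.
  case: eqP => [E|_]; first by move: Hlt; rewrite E symb_ltE ltnn.
  by rewrite ifF ?addn0 // symb_ltE; move: Hlt; rewrite symb_ltE; lia.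
have /= E0 := Heq 0 (ltn0Sn _); rewrite -E0 eqxx (IH _ _ j) ?addnS // => i Hi.
exact: (Heq i.+1).
Qed.

Lemma key_from_eq l P X : (forall i, i < size P -> nth d P i = nth d X i) ->
  size P <= size X -> key_from l P X = 3 * n.
Proof.
elim: P l X => [|p P IH] l [|x X] //= H Hs; have /= E0 := H 0 (ltn0Sn _);
  rewrite -E0 eqxx.
by apply: IH => // i Hi; apply: (H i.+1).
Qed.

Definition mismatch P X j : Prop :=
  [/\ j < size P, forall i, i < j -> nth d P i = nth d X i
    & symb_lt (nth d X j) (nth d P j) \/ symb_lt (nth d P j) (nth d X j)].

Lemma mismatchP P X : (forall i, i < size P -> nth d P i = nth d X i) \/
  exists j, mismatch P X j.
Proof.
have [H|/hasPn H] := boolP (has (fun i =>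
  nth d P i != nth d X i) (iota 0 (size P))).
  right; have := H; rewrite has_find size_iota; set j := find _ _ => Hj.
  exists j; split=> //.
    move=> i Hi; have := before_find 0 Hi; rewrite nth_iota ?add0n; last by lia.
    by move/negbFE/eqP.
  have := nth_find 0 H; rewrite -/j nth_iota // add0n !symb_ltE.
  by rewrite -(inj_eq symb_rank_inj); case: ltngtP; auto.
by left=> i Hi; have := H i; rewrite mem_iota negbK => /(_ Hi)/eqP.
Qed.

Definition zflags X : seq bool := [seq x == d | x <- X].

Lemma nth_zflags X i : i < size X -> nth false (zflags X) i = (nth d X i == d).
Proof. by move=> Hi; rewrite (nth_map d). Qed.

Lemma zeros_take X l : zeros (take l X) = nzeros (zflags X) l.
Proof. by rewrite /nzeros -map_take count_map; apply: eq_count. Qed.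

Lemma eq_nzeros P X l : l <= size P -> l <= size X ->
  (forall i, i < l -> nth d P i = nth d X i) ->
  forall i, i <= l -> nzeros (zflags P) i = nzeros (zflags X) i.
Proof.
move=> HP HX E i Hi; rewrite -!zeros_take; congr zeros.
apply: (@eq_from_nth _ d) => [|j]; rewrite !size_takel; try lia.
by move=> Hj; rewrite !nth_take // E //; lia.
Qed.

(** Lets an entry of [L] decide whether a first occurrence [a] lies before position [l]. *)
Lemma nzeros_lt_rank X a l : a < size X -> nth d X a = d ->
  (nzeros (zflags X) l < (nzeros (zflags X) a).+1) = (l <= a).
Proof.
move=> Ha E; rewrite ltnS; case: (leqP l a) => [/leq_nzeros -> //|Hl].
have := leq_nzeros (zflags X) Hl; rewrite nzerosS ?size_map // nth_zflags // E.
by rewrite eqxx; lia.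
Qed.

Definition bounded X : Prop := forall i k, nth d X i = inr k -> k <= i.

(** The p-strings are abstracted away: only the rewritten entries and the bound of each entry by its
    position matter. That bound puts a rewritten [i.+1] above any integer it meets. *)
Lemma key_param_step P X P' X' a b l m : size P = m -> m < n ->
  m <= size X -> size P' = m.+1 -> m < size X' ->
  nth d P' 0 = d -> nth d X' 0 = d ->
  (forall i, i < m -> nth d P' i.+1 = if i == b then inr i.+1 else nth d P i) ->
  (forall i, i < m -> nth d X' i.+1 = if i == a then inr i.+1 else nth d X i) ->
  (b < m -> nth d P b = d) -> a < size X -> nth d X a = d ->
  bounded P -> bounded X -> mismatch P X l ->
  key P' X' = new_key_param n (zflags P) (if b < m then b else n) (key P X)
                (nzeros (zflags X) a).+1.
Proof.
move=> sP Hm sX sP' sX' P0 X0 EP EX Eb Ha Ea BP BX [Hl Heq Hlt].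
rewrite sP in Hl; have Hz := @eq_nzeros P X l (ltac:(lia)) (ltac:(lia)) Heq.
(* An absent symbol has index [m]; moving it to [n] places it beyond every mismatch. *)
set c := if b < m then b else n.
have Hc : c < m -> c = b by rewrite /c; case: ifP; lia.
have Hc' : m <= c -> c = n by rewrite /c; case: ifP; lia.
have lo j : j < m -> (forall i, i < j -> nth d P' i.+1 = nth d X' i.+1) ->
    symb_lt (nth d X' j.+1) (nth d P' j.+1) ->
    key P' X' = 3 * (j + 1) + symb_class (nth d X' j.+1).
  move=> Hj E H; rewrite /key (@key_from_lo _ _ _ j.+1) ?sP' ?add0n ?addn1 //;
    try lia.
  by case=> [|i]; rewrite ?P0 ?X0 // ltnS; apply: E.
have hi j : j < m -> (forall i, i < j -> nth d P' i.+1 = nth d X' i.+1) ->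
    symb_lt (nth d P' j.+1) (nth d X' j.+1) -> key P' X' = 4 * n - (j + 1).
  move=> Hj E H; rewrite /key (@key_from_hi _ _ _ j.+1) ?sP' ?add0n ?addn1 //;
    try lia.
  by case=> [|i]; rewrite ?P0 ?X0 // ltnS; apply: E.
have agree j : j <= l -> (forall i, i < j -> (i == a) = (i == b)) ->
    forall i, i < j -> nth d P' i.+1 = nth d X' i.+1.
  by move=> Hj E i Hi; rewrite EP ?EX ?E ?Heq //; lia.
have bsmall : c < l -> c < a -> key P' X' = 3 * (c + 1) + 1.
  move=> Hcl Hca; have Ecb : c = b by apply: Hc; lia.
  have EXc : nth d X' c.+1 = d.
    by rewrite EX ?ifF -?Heq ?Ecb ?Eb //; lia.
  rewrite (lo c) ?EXc //; first by lia.
    by apply: agree; [lia | move=> i Hi; lia].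
  by rewrite EP ?ifT //; lia.
have asmall : a < l -> a < c -> key P' X' = 4 * n - (a + 1).
  move=> Hal Hac; have Nab : a != b by move: Hac; rewrite /c; case: ifP; lia.
  apply: hi; [lia | apply: agree; [lia|] |].
    by move=> i Hi; move: Hac; rewrite /c; case: ifP; lia.
  by rewrite EP ?EX ?eqxx ?ifF ?Heq ?Ea //; lia.
set h := (nzeros (zflags X) a).+1.
(* The flags of [P] find the zero number [h] of the row as long as it lies before [l], where the two
   encodings coincide. *)
have EA : (if nzeros (zflags P) l < h then n else zero_pos (zflags P) h)
    = if a < l then a else n.
  rewrite Hz // nzeros_lt_rank //; case: leqP => // Hal.
  rewrite /h -Hz ?zero_posE ?size_map ?sP ?nth_zflags ?Heq ?Ea ?sP //; lia.
have Eh : nth d X l = d -> l <= a -> (h == nzeros (zflags P) l + 1) = (a == l).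
  move=> El Hla; rewrite Hz // addn1 eqSS; apply/eqP/eqP => [E|-> //].
  apply/eqP; rewrite eqn_leq Hla andbT -(@nzeros_lt_rank X l a) ?E //; lia.
have same : a = c -> forall i, i < l -> (i == a) = (i == b).
  by move=> E i Hi; move: E; rewrite /c; case: ifP => [_ ->|] //; lia.
have past : l <= a -> l <= c -> forall i, i < l -> (i == a) = (i == b).
  by move=> Hla Hlc i Hi; move: Hlc; rewrite /c; case: ifP; lia.
have Nb : l < c -> l <> b by rewrite /c; case: ifP; lia.
case: Hlt => Hlt.
  have := @key_from_lo 0 P X l; rewrite sP add0n =>
    /(_ Hl (leq_trans Hl sX) Heq Hlt).
  rewrite -/(key P X) => Ek; have Cl := symb_class_le (nth d X l).
  rewrite /new_key_param /shift_key Ek.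
  have -> : (3 * l + symb_class (nth d X l) < 3 * n) = true by lia.
  have -> : (3 * l + symb_class (nth d X l)) %/ 3 = l by lia.
  have -> : (3 * l + symb_class (nth d X l)) %% 3 = symb_class (nth d X l) by lia.
  rewrite EA -/h; have [Hal|Hla] := ltnP a l.
    rewrite Hal; case: eqP => [Eac|Nac].
      rewrite (lo l); [by rewrite EX ?ifF //; lia | by [] | exact/agree/same |].
      by have Ebl : b = c by [rewrite Hc; lia]; rewrite EP // EX // !ifF //; lia.
    by case: ltnP => Hac; [exact: asmall | apply: bsmall; lia].
  rewrite ifF; last by lia.
  have [Hcl|Hlc] := ltnP c l; first by apply: bsmall; lia.
  have ag := agree l (leqnn l) (past Hla Hlc).
  have Ecl : (symb_class (nth d X l) == 1) = (nth d X l == d) by case: (nth d X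
    l) => // -[].
  rewrite Ecl; case: eqP => [El|Nl] /=; last first.
    have Nal : a <> l by move=> E; rewrite E in Ea.
    have EXl : nth d X' l.+1 = nth d X l by rewrite EX // ifF //; lia.
    rewrite (lo l) ?EXl //; first by lia.
    rewrite EP //; case: eqP => // Elb; move: Hlt; rewrite Elb Eb; last by lia.
    by case: (nth d X b).
  (* If [a = l], the 0 of the row becomes [l.+1], while the entry of [P] is a positive integer at
     most [l]: the row changes to the larger side. *)
  rewrite Eh //; case: eqP => [Eal|Nal].
    have := BP l; case EPl : (nth d P l) Hlt => [q|k] //=; rewrite El //= =>
      k0 /(_ k erefl) Hk.
    apply: hi => //; rewrite EP ?EX // Eal eqxx ifF ?EPl //=.
    by apply/eqP => Elb; rewrite Elb Eb in EPl; [case: EPl; lia | lia].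
  have EXl : nth d X' l.+1 = nth d X l by rewrite EX // ifF //; lia.
  rewrite (lo l) ?EXl //; first by lia.
  rewrite EP //; case: eqP => // Elb; move: Hlt; rewrite Elb Eb; last by lia.
  by rewrite symb_ltE -Elb El ltnn.
have := @key_from_hi 0 P X l; rewrite sP add0n => /(_ Hl (leq_trans Hl sX) Heq Hlt).
rewrite -/(key P X) => Ek.
rewrite /new_key_param /shift_key Ek.
have -> : (4 * n - l < 3 * n) = false by lia.
have -> : 4 * n - (4 * n - l) = l by lia.
rewrite EA -/h; have [Hal|Hla] := ltnP a l.
  rewrite Hal; case: eqP => [Eac|Nac].
    rewrite (hi l); [by lia | by [] | exact/agree/same |].
    by have Ebl : b = c by [rewrite Hc; lia]; rewrite EP // EX // !ifF //; lia.
  by case: ltnP => Hac; [exact: asmall | apply: bsmall; lia].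
rewrite ifF; last by lia.
have [Hcl|Hlc] := ltnP c l; first by apply: bsmall; lia.
have ag := agree l (leqnn l) (past Hla Hlc).
(* The mirror case: the 0 of [P] at [l] becomes [l.+1] and exceeds the entry of the row, a positive
   integer at most [l]. The row changes to the smaller side, with class 2. *)
case: eqP => [Ecl|Ncl].
  have Elb : l = b by rewrite -Hc //; lia.
  have EPl : nth d P l = d by rewrite Elb; apply: Eb; lia.
  have := BX l; case EXl : (nth d X l) Hlt => [q|k]; rewrite EPl //= =>
    k0 /(_ k erefl) Hk.
  have Nla : (l == a) = false by apply/eqP => E; rewrite E Ea in EXl;
    case: EXl; lia.
  have EX'l : nth d X' l.+1 = inr k by rewrite EX // Nla.
  rewrite (lo l) ?EX'l //=; first by case: (k) k0.
  by rewrite EP // ifT /=; lia.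
rewrite (hi l) //; first by lia.
rewrite EP // ifF; last by apply/eqP/Nb; lia.
rewrite EX //; case: eqP => // Ela; move: Hlt; rewrite Ela Ea.
by case: (nth d P a) => // k; rewrite ltn0.
Qed.


End Key.

Notation d := (inr 0 : Ss + nat).

(** * Prev-encodings under prepending *)

Lemma size_prev_from u w : size (prev_from u w) = size w.
Proof. by elim: w u => //= x w IH u; rewrite IH. Qed.

Lemma size_prev_enc w : size (prev_enc w) = size w.
Proof. exact: size_prev_from. Qed.

Lemma nth_prev_from (z0 : Ss + Sp) u w i : i < size w ->
  nth d (prev_from u w) i = prev_symbol (u ++ take i w) (nth z0 w i).
Proof.
elim: w u i => //= x w IH u [|i] Hi /=; first by rewrite cats0.
by rewrite IH // cat_rcons.
Qed.

Lemma nth_prev_enc (z0 : Ss + Sp) w i : i < size w ->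
  nth d (prev_enc w) i = prev_symbol (take i w) (nth z0 w i).
Proof. exact: nth_prev_from. Qed.

Lemma prev_enc_take k w : prev_enc (take k w) = take k (prev_enc w).
Proof.
by rewrite /prev_enc; elim: w k [::] => [|x w IH] [|k] u //=; rewrite IH.
Qed.

Lemma prev_enc_bounded w : bounded (prev_enc w).
Proof.
move=> i k; have [Hi|Hi] := ltnP i (size w); last first.
  by rewrite nth_default ?size_prev_enc // => -[<-].
have x0 : Ss + Sp by case: (w) Hi.
rewrite (nth_prev_enc x0) //; case: (nth x0 w i) => // p /=.
case: ifP => [Hp [<-]|_ [<-//]]; apply: leq_trans (_ : size (take i w) <= i).
  by rewrite -size_rev index_mem mem_rev.
by rewrite size_takel // ltnW.
Qed.

Lemma prev_enc_index p w : inr p \in w ->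
  nth d (prev_enc w) (index (inr p) w) = d.
Proof.
move=> Hp; rewrite (nth_prev_enc (inr p)) ?index_mem // nth_index //=.
by rewrite in_take // ltnn.
Qed.

Lemma inr_inj (A B : Type) : injective (@inr A B).
Proof. by move=> ? ? []. Qed.

Lemma inl_inj (A B : Type) : injective (@inl A B).
Proof. by move=> ? ? []. Qed.

(** Later occurrences of [x] have a nearer predecessor inside [w]. If [x] is absent, its index is
    [size w] and the test never succeeds. *)
Lemma nth_prev_cons (x : Ss + Sp) w i : i < size w ->
  nth d (prev_enc (x :: w)) i.+1 =
  match x with
  | inl _ => nth d (prev_enc w) i
  | inr _ => if i == index x w then inr i.+1 else nth d (prev_enc w) i
  end.
Proof.
move=> Hi; rewrite (nth_prev_enc x) // [take _ _]/= [nth _ _ _]/= (nth_prev_enc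
  x Hi).
have st : size (take i w) = i by rewrite size_takel // ltnW.
case Ey: (nth x w i) => [b|q] /=.
  case: x Ey => // p Ey; case: eqP => // E.
  by rewrite E nth_index // in Ey; rewrite -index_mem -E.
rewrite inE rev_cons -cats1 index_cat mem_rev size_rev st /=.
have Hin : (inr q \in take i w) = (index (inr q) w < i).
  by rewrite in_take // -Ey mem_nth.
case: x Ey => [a|p] Ey /=; first by case: (_ \in _).
rewrite (inj_eq (@inr_inj _ _)) [inr p == _](inj_eq (@inr_inj _ _)) [p == q]eq_sym.
have [Epq|Npq] := eqVneq q p.
  have := index_nth (inr p) Hi; rewrite Ey -Epq Hin /=.
  by case: ltngtP => // <- _; rewrite addn0.
have -> : (i == index (inr p) w) = false.
  apply/eqP => E; move: Ey; rewrite E nth_index => [[]|];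
    last by rewrite -index_mem -E.
  by move=> Epq; rewrite Epq eqxx in Npq.
by case: (_ \in _).
Qed.

Variable dollar : Ss.

(** [L] refers to the row [rcons v q], whereas the next encoding is governed by the index of [q] in
    [v]. They agree even if [q] is not in [v]. *)
Lemma index_rcons_last (x : Ss + Sp) w : index x (rcons w x) = index x w.
Proof.
rewrite -cats1 index_cat /= eqxx addn0; case: ifP => // /negbT.
by rewrite -index_mem -leqNgt => H; apply/eqP; rewrite eqn_leq H index_size.
Qed.

(** The successor counts the 0 at the first occurrence itself; hence an entry of [L] is never the
    integer 0. *)
Definition param_rank w (p : Sp) : nat :=
  (nzeros (zflags (prev_enc w)) (index (inr p) w)).+1.

Lemma pBWT_symbol_param v p : pBWT_symbol dollar (rcons v (inr p)) =
  inr (param_rank (rcons v (inr p)) p).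
Proof.
rewrite /pBWT_symbol last_rcons prev_enc_take zeros_take; congr inr.
have Hp : inr p \in rcons v (inr p) by rewrite mem_rcons mem_head.
rewrite nzerosS ?size_map ?size_prev_enc ?index_mem // nth_zflags
  ?size_prev_enc ?index_mem //.
by rewrite prev_enc_index // eqxx addn1.
Qed.

Lemma pBWT_symbol_static v a : pBWT_symbol dollar (rcons v (inl a)) = inl a.
Proof. by rewrite /pBWT_symbol last_rcons. Qed.

Lemma code_L_param k : code_L (inr k : Ss + nat) %% 2 = 1 /\ code_L (inr k : Ss
  + nat) %/ 2 = k.
Proof. by rewrite /=; lia. Qed.

Lemma code_L_static a : code_L (inl a : Ss + nat) %% 2 = 0.
Proof. by rewrite /= /code_s; lia. Qed.

(** The rank refers to the whole row [w], the flags only to its first [m] symbols. Since the zeros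
    of both agree there, a rank beyond their number means that [p] first occurs later. *)
Lemma first_occ_param n m w p : inr p \in w -> m <= size w ->
  first_occ n (zflags (prev_enc (take m w))) (code_L (inr (param_rank w p) : Ss
    + nat))
  = if index (inr p) (take m w) < m then index (inr p) (take m w) else n.
Proof.
move=> Hp Hm; have [E1 E2] := code_L_param (param_rank w p).
have st : size (take m w) = m by rewrite size_takel.
rewrite /first_occ E1 E2 eqxx size_map size_prev_enc st.
have Hz : forall i, i <= m -> nzeros (zflags (prev_enc (take m w))) i =
    nzeros (zflags (prev_enc w)) i.
  apply: eq_nzeros; rewrite ?size_prev_enc ?st // => i Hi.
  by rewrite prev_enc_take nth_take.
have Hj : index (inr p) w < size w by rewrite index_mem.
rewrite Hz // nzeros_lt_rank ?size_prev_enc ?prev_enc_index //.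
have Hi : (index (inr p) (take m w) < m) = (index (inr p) w < m).
  by rewrite -{2}st index_mem in_take.
rewrite Hi ltnNge; case: leqP => //= Hjm.
have Hpt : inr p \in take m w by rewrite in_take.
have Ei : index (inr p) (take m w) = index (inr p) w.
  by rewrite -{2}(cat_take_drop m w) index_cat Hpt.
rewrite /param_rank -Hz; last exact: ltnW.
by rewrite zero_posE ?Ei // ?size_map ?nth_zflags ?size_prev_enc ?st // -Ei
  prev_enc_index.
Qed.

Lemma code_L_lt (a b : Ss) : (code_L (inl a : Ss + nat) < code_L (inl b : Ss +
  nat)) = (a < b)%O.
Proof. by rewrite /= /code_s enum_rank_lt; lia. Qed.

Lemma code_L_inj (a b : Ss) : code_L (inl a : Ss + nat) = code_L (inl b : Ss +
  nat) -> a = b.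
Proof.
rewrite /= /code_s => E; apply: Order.EnumVal.enum_rank_inj.
by apply: ord_inj; lia.
Qed.

(** [rcons t p] is the row starting with the known suffix and [rcons v q] any row that mismatches
    it. Static symbols rewrite nothing; two parameters both become a leading 0 and lead to
    [key_param_step]. *)
Lemma new_key_step n m (t v : seq (Ss + Sp)) (p q : Ss + Sp) l :
  size (rcons t p) = n -> size (rcons v q) = n -> m < n ->
  mismatch (prev_enc (take m (rcons t p))) (prev_enc (rcons v q)) l ->
  key n (prev_enc (p :: take m (rcons t p))) (prev_enc (q :: v)) =
  new_key n (zflags (prev_enc (take m (rcons t p))))
    (code_L (pBWT_symbol dollar (rcons t p)))
    (key n (prev_enc (take m (rcons t p))) (prev_enc (rcons v q)))
    (code_L (pBWT_symbol dollar (rcons v q))).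
Proof.
move=> sT sV Hm HM; set u := take m _ in HM *;
  set X := prev_enc (rcons v q) in HM *.
have su : size u = m by rewrite size_takel ?sT // ltnW.
have sv : size v = n.-1 by rewrite -sV size_rcons.
have sP : size (prev_enc u) = m by rewrite size_prev_enc.
have sX : size X = n by rewrite size_prev_enc.
have EX i : i < m -> nth d (prev_enc v) i = nth d X i.
  move=> Hi; have -> : v = take (size v) (rcons v q) by rewrite -cats1
    take_size_cat.
  by rewrite prev_enc_take nth_take //; lia.
have Ek : (key n (prev_enc u) X == 3 * n) = false.
  case: (HM) => H1 H2 [] H3; apply/eqP; rewrite /key.
    by rewrite (key_from_lo _ _ H1 _ H2 H3) ?sX;
      have := symb_class_le (nth d X l); lia.
  by rewrite (key_from_hi _ _ H1 _ H2 H3) ?sX; lia.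
rewrite /new_key Ek.
have Hl : l < m by case: HM; rewrite sP.
have sP' : size (prev_enc (p :: u)) = m.+1 by rewrite size_prev_enc /= su.
have sX' : size (prev_enc (q :: v)) = n by rewrite size_prev_enc /= sv; lia.
case: p q @u @X sT sV su sv sP sX sP' sX' EX HM Ek =>
  [c|p] [e|q] u X sT sV su sv sP sX sP' sX' EX HM Ek.
- rewrite !pBWT_symbol_static !code_L_static (_ : (0 == 1) = false) //.
  case: eqP => [/code_L_inj E|NE].
    have EPS i : i < m -> nth d (prev_enc (inl c :: u)) i.+1 = nth d (prev_enc u) i.
      by move=> Hi; rewrite nth_prev_cons ?su.
    have EXS i : i < m -> nth d (prev_enc (inl e :: v)) i.+1 = nth d X i.
      by move=> Hi; rewrite nth_prev_cons ?EX ?sv //; lia.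
    have Heq : forall i, i < l.+1 ->
      nth d (prev_enc (inl c :: u)) i = nth d (prev_enc (inl e :: v)) i.
      case: HM => _ H2 _ [|i] Hi; first by rewrite /= E.
      by rewrite EPS ?EXS ?H2 //; lia.
    rewrite /shift_key /key; case: (HM) => H1 H2 [] H3.
      rewrite (key_from_lo _ _ (j := l.+1)) ?sP' ?sX' ?EPS ?EXS //; try lia.
      rewrite (key_from_lo _ _ H1 _ H2 H3) ?sX;
        have := symb_class_le (nth d X l); try lia.
      by case: ifP; lia.
    rewrite (key_from_hi _ _ (j := l.+1)) ?sP' ?sX' ?EPS ?EXS //; try lia.
    by rewrite (key_from_hi _ _ H1 _ H2 H3) ?sX; try lia; case: ifP; lia.
  have Nce : e <> c by move=> E; rewrite E in NE.
  rewrite code_L_lt /key /= (inj_eq (@inl_inj _ _)).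
  by case: eqP => // _; case: ifP => _; rewrite ?muln0 ?subn0.
- rewrite pBWT_symbol_static pBWT_symbol_param code_L_static (code_L_param _).1 /=.
  by rewrite /key /= subn0.
- rewrite pBWT_symbol_static pBWT_symbol_param code_L_static (code_L_param _).1.
  rewrite eqxx (_ : (0 == 1) = false) // ifF //; apply/eqP => E.
  by have := code_L_static e; rewrite E (code_L_param _).1.
rewrite !pBWT_symbol_param !(code_L_param _).1 !(code_L_param _).2 !eqxx.
rewrite first_occ_param; [| by rewrite mem_rcons mem_head | by lia].
apply: (key_param_step (X := X) (l := l)) => //.
- by rewrite sX ltnW.
- by rewrite sX'.
- by move=> i Hi; rewrite nth_prev_cons ?su.
- by move=> i Hi; rewrite nth_prev_cons ?EX ?index_rcons_last ?sv //; lia.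
- by move=> Hi; apply: prev_enc_index; rewrite -index_mem su.
- by rewrite sX -sV index_mem mem_rcons mem_head.
- by apply: prev_enc_index; rewrite mem_rcons mem_head.
- exact: prev_enc_bounded.
- exact: prev_enc_bounded.
Qed.


End PStrings.


(** * Correctness of the inversion algorithm *)

Section Params.

Variables (ds dp : Order.disp_t).
Variables (Ss : finOrderType ds) (Sp : finOrderType dp).
Implicit Types (w : seq (Ss + Sp)) (p : Sp).

(* undup keeps last occurrences, so the reverse of this sequence lists the
   parameter symbols in the order of their discovery from right to left. *)
Definition params w : seq Sp :=
  undup (pmap (fun x : Ss + Sp => if x is inr p then Some p else None) w).

Lemma mem_params p w : (p \in params w) = (inr p \in w).
Proof.
by rewrite mem_undup; elim: w => //= -[a|q] w IH; rewrite !inE IH.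
Qed.

Lemma params_param p w :
  params (inr p :: w) = if inr p \in w then params w else p :: params w.
Proof. by rewrite -mem_params mem_undup. Qed.

Lemma params_cat w1 w2 : exists s, params (w1 ++ w2) = s ++ params w2.
Proof.
elim: w1 => [|[a|p] w1 [s IH]]; [by exists [::] | by exists s |].
by rewrite cat_cons params_param IH; case: ifP => _; [exists s | exists (p :: s)].
Qed.

Lemma size_params w : size (params w) <= size w.
Proof.
apply: leq_trans (size_undup _) _; rewrite size_pmap; exact: count_size.
Qed.

Lemma zip_maps (A : Type) (f g : A -> nat) s :
  zip (map f s) (map g s) = [seq (f i, g i) | i <- s].
Proof. by elim: s => //= i s ->. Qed.

End Params.

Section Inversion.

Variables (ds dp : Order.disp_t).
Variables (Ss : finOrderType ds) (Sp : finOrderType dp).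
Variables (dollar : Ss) (T' : seq (Ss + Sp)).
Hypothesis dollar_min : forall a : Ss, (dollar <= a)%O.
Hypothesis dollar_notin : inl dollar \notin T'.

Let T := rcons T' (inl dollar).
Let n := size T.
Let x0 : Ss + Sp := inl dollar.
Let L := map (@code_L _ Ss) (pBWT dollar T).

Notation d := (inr 0 : Ss + nat).
Notation row i := (prev_enc (rotation T i)).

Definition tail m := drop (n - m) T.

Definition keys m := [seq key n (prev_enc (tail m)) (row i) | i <- tau T].

Definition prev_row i := if i == 1 then n else i.-1.

Lemma n_gt0 : 0 < n. Proof. by rewrite /n size_rcons. Qed.

Lemma size_rotation i : size (rotation T i) = n.
Proof. exact: size_rot. Qed.

Lemma perm_tau : perm_eq (tau T) (iota 1 n).
Proof. by rewrite perm_sort. Qed.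

Lemma uniq_tau : uniq (tau T).
Proof. by rewrite sort_uniq iota_uniq. Qed.

Lemma mem_tau i : (i \in tau T) = (0 < i <= n).
Proof. by rewrite (perm_mem perm_tau) mem_iota; lia. Qed.

Lemma size_tau : size (tau T) = n.
Proof. by rewrite (perm_size perm_tau) size_iota. Qed.

Lemma prev_row_range i : 0 < i <= n -> 0 < prev_row i <= n.
Proof. by rewrite /prev_row; case: eqP; lia. Qed.

(** All that is used of the LF-mapping: stepping back is a bijection on rotations. *)
Lemma perm_prev_row : perm_eq (map prev_row (tau T)) (tau T).
Proof.
apply: uniq_perm; rewrite ?uniq_tau //.
  rewrite map_inj_in_uniq ?uniq_tau // => i j; rewrite !mem_tau /prev_row.
  by do 2!case: eqP; lia.
move=> i; rewrite mem_tau; apply/mapP/idP => [[j]|Hi].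
  by rewrite mem_tau => /prev_row_range + ->.
exists (if i == n then 1 else i.+1); rewrite ?mem_tau /prev_row.
  by case: eqP; lia.
by have [->|Ni] := eqVneq i n; rewrite ?eqxx //; case: eqP; lia.
Qed.

Lemma rotation_prev i (t : seq (Ss + Sp)) p : 0 < i <= n ->
  rotation T i = rcons t p -> rotation T (prev_row i) = p :: t.
Proof.
move=> Hi E; rewrite -rotr1_rcons -E /rotation /prev_row.
case: eqP => [->|Ni]; first by rewrite rot0 /rotr subn1.
have -> : i.-1 = i.-2.+1 by lia.
by rewrite rotS ?rotK // -/n; lia.
Qed.

Lemma tail_rotation m : m <= n -> tail m = take m (rotation T (n - m).+1).
Proof.
by move=> Hm; rewrite /rotation /= /rot take_size_cat // size_drop -/n; lia.
Qed.

Lemma size_tail m : m <= n -> size (tail m) = m.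
Proof. by move=> Hm; rewrite size_drop -/n; lia. Qed.

Lemma tailS m (t : seq (Ss + Sp)) p : 0 < m < n ->
  rotation T (n - m).+1 = rcons t p -> tail m.+1 = p :: tail m.
Proof.
move=> Hm E; have st : size t = n.-1 by rewrite -(size_rotation (n - m).+1) E
  size_rcons.
have Hi : 0 < (n - m).+1 <= n by lia.
rewrite !tail_rotation ?E; try lia.
have := rotation_prev Hi E; rewrite /prev_row ifF; last by lia.
have -> : (n - m).+1.-1 = (n - m.+1).+1 by lia.
move=> -> /=.
by rewrite -cats1 takel_cat //; lia.
Qed.

Lemma tail_full : tail n = T.
Proof. by rewrite /tail subnn drop0. Qed.

Lemma tail1 : tail 1 = [:: inl dollar].
Proof. by rewrite /tail /n size_rcons subn1 /T -cats1 drop_size_cat. Qed.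

Lemma nth_T j : j < n -> nth x0 T j = inl dollar -> j = n.-1.
Proof.
rewrite /n size_rcons nth_rcons /= => Hj; case: ltnP => [Hj' E|]; last by lia.
by move: dollar_notin; rewrite -E mem_nth.
Qed.

Lemma nth_rotation i j : 0 < i <= n -> j < n ->
  nth x0 (rotation T i) j = nth x0 T (if i.-1 + j < n then i.-1 + j else i.-1 +
    j - n).
Proof.
move=> Hi Hj; rewrite /rotation /rot nth_cat size_drop -/n nth_drop.
case: ifP => H; first by rewrite ifT //; lia.
by rewrite ifF ?nth_take; try lia; congr nth; lia.
Qed.

Lemma nth_prev_static w i a : i < size w -> nth d (prev_enc w) i = inl a ->
  nth x0 w i = inl a.
Proof.
move=> Hi; rewrite (nth_prev_enc x0) //; rewrite /prev_symbol.
by case: (nth x0 w i) => [b [->]|p] //; case: (inr p \in take i w).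
Qed.

Lemma row_tail m : 0 < m <= n ->
  forall j, j < m -> nth d (prev_enc (tail m)) j = nth d (row (n - m).+1) j.
Proof.
by move=> Hm j Hj; rewrite tail_rotation ?prev_enc_take ?nth_take //; lia.
Qed.

(* The end marker of the suffix determines where a matching row starts. *)
Lemma row_unique m i : 0 < m <= n -> 0 < i <= n ->
  (forall j, j < m -> nth d (prev_enc (tail m)) j = nth d (row i) j) ->
  i = (n - m).+1.
Proof.
move=> Hm Hi H.
have Em : nth d (prev_enc (tail m)) m.-1 = inl dollar.
  have sm := @size_tail m.
  rewrite (nth_prev_enc x0); last by lia.
  by rewrite /tail nth_drop nth_rcons ifF ?ifT //; move: Hm;
    rewrite /n size_rcons; lia.
have := nth_prev_static (w := rotation T i) (i := m.-1) (a := dollar).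
rewrite size_rotation -H ?Em; last by lia.
move=> /(_ (ltac:(lia)) erefl); rewrite nth_rotation //; last by lia.
by move/nth_T; case: ifP; lia.
Qed.

Lemma mismatch_row m i : 0 < m <= n -> 0 < i <= n -> i <> (n - m).+1 ->
  exists l, mismatch (prev_enc (tail m)) (row i) l.
Proof.
move=> Hm Hi Ni; have [H|//] := mismatchP (prev_enc (tail m)) (row i).
case: Ni; apply: row_unique => // j Hj; apply: H.
by rewrite size_prev_enc size_tail //; lia.
Qed.

Lemma key_row m : 0 < m <= n -> key n (prev_enc (tail m)) (row (n - m).+1) = 3 * n.
Proof.
move=> Hm; have sm := @size_tail m.
apply: key_from_eq; rewrite size_prev_enc ?sm; try lia.
  exact: row_tail.
by rewrite size_prev_enc size_rotation; lia.
Qed.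

Lemma valid_key_row m i : 0 < m <= n -> 0 < i <= n ->
  valid_key n m (key n (prev_enc (tail m)) (row i)) /\
  (key n (prev_enc (tail m)) (row i) = 3 * n -> i = (n - m).+1).
Proof.
move=> Hm Hi; have [->|/eqP Ni] := eqVneq i (n - m).+1.
  by rewrite key_row // /valid_key eqxx.
have [l [Hl Heq Hlt]] := mismatch_row Hm Hi Ni.
have Hln : l < size (row i).
  by move: Hl; rewrite !size_prev_enc size_rotation size_tail; lia.
have Hlm : l < m by move: Hl; rewrite size_prev_enc size_tail //; lia.
rewrite /key /valid_key; case: Hlt => Hlt.
  by rewrite (key_from_lo _ _ Hl) // add0n;
    have := symb_class_le (nth d (row i) l); lia.
by rewrite (key_from_hi _ _ Hl) // add0n; lia.
Qed.

Lemma nth_keys m j : j < n ->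
  nth 0 (keys m) j = key n (prev_enc (tail m)) (row (nth 0 (tau T) j)).
Proof. by move=> Hj; rewrite (nth_map 0) ?size_tau. Qed.

Lemma tau_range j : j < n -> 0 < nth 0 (tau T) j <= n.
Proof. by move=> Hj; rewrite -mem_tau mem_nth ?size_tau. Qed.

Lemma size_keys m : size (keys m) = n.
Proof. by rewrite size_map size_tau. Qed.

Lemma mid_keys m : 0 < m <= n -> 3 * n \in keys m.
Proof.
by move=> Hm; apply/mapP; exists (n - m).+1; rewrite ?key_row // mem_tau; lia.
Qed.

Lemma index_keys_lt m : 0 < m <= n -> index (3 * n) (keys m) < n.
Proof. by move=> Hm; have := mid_keys Hm; rewrite -index_mem size_keys. Qed.

Lemma tau_index_keys m : 0 < m <= n ->
  nth 0 (tau T) (index (3 * n) (keys m)) = (n - m).+1.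
Proof.
move=> Hm; have Hj := index_keys_lt Hm.
apply: (valid_key_row Hm (tau_range Hj)).2.
by rewrite -nth_keys // nth_index // mid_keys.
Qed.

Lemma valid_keys_keys m : 0 < m <= n -> valid_keys n m (keys m).
Proof.
move=> Hm; split; rewrite ?size_keys ?mid_keys //.
  by apply/allP => k /mapP[i]; rewrite mem_tau => Hi ->;
    case: (valid_key_row Hm Hi).
move=> j; have n0 := n_gt0; have [Hj|Hj] := ltnP j n; last first.
  by rewrite nth_default ?size_keys //; lia.
rewrite nth_keys // => /(valid_key_row Hm (tau_range Hj)).2.
rewrite -(tau_index_keys Hm) => /eqP; rewrite nth_uniq ?size_tau ?uniq_tau //.
  by move/eqP.
exact: index_keys_lt.
Qed.

Lemma L_map : L = [seq code_L (pBWT_symbol dollar (rotation T i)) | i <- tau T].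
Proof. by rewrite /L /pBWT -map_comp. Qed.

Lemma next_code_keys m : 0 < m <= n ->
  next_code n L (keys m) = code_L (pBWT_symbol dollar (rotation T (n - m).+1)).
Proof.
move=> Hm; rewrite /next_code L_map (nth_map 0) ?tau_index_keys //.
by rewrite size_tau index_keys_lt.
Qed.

Lemma rotation_rcons i : exists (t : seq (Ss + Sp)) p, rotation T i = rcons t p.
Proof.
have := size_rotation i; have := n_gt0.
by case/lastP: (rotation T i) => [/= + E|t p _ _]; [rewrite -E | exists t, p].
Qed.

Lemma sorted_keys m : 0 < m <= n -> sorted leq (keys m).
Proof.
move=> Hm; rewrite /keys sorted_map.
apply: sub_sorted (_ : sorted (fun i j => lex_le (row i) (row j)) _).
  by move=> i j /= H; apply: key_from_mono H;
    rewrite ?size_prev_enc ?size_rotation ?size_tail //; lia.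
by apply: sort_sorted => i j; apply: lex_le_total.
Qed.

(** Two sorted lists with the same multiset are equal. Each new key belongs to the preceding
    rotation, and [perm_prev_row] shows that every rotation is reached once. *)
Lemma new_keys_keys m : 0 < m < n ->
  sort leq (new_keys n L (zflags (prev_enc (tail m))) (keys m)) = keys m.+1.
Proof.
move=> Hm; apply: (sorted_eq leq_trans anti_leq).
- exact/sort_sorted/leq_total.
- by apply: sorted_keys; lia.
rewrite perm_sort /new_keys next_code_keys; last by lia.
rewrite L_map zip_maps -map_comp.
have -> : map ((fun p => new_key n (zflags (prev_enc (tail m)))
      (code_L (pBWT_symbol dollar (rotation T (n - m).+1))) p.1 p.2) \o
    (fun i => (key n (prev_enc (tail m)) (row i),
               code_L (pBWT_symbol dollar (rotation T i))))) (tau T) =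
    [seq key n (prev_enc (tail m.+1)) (row i) | i <- map prev_row (tau T)].
  rewrite -map_comp; apply/eq_in_map => i; rewrite mem_tau => Hi /=.
  (* The row that starts with the suffix has no mismatch to update; its predecessor starts with the
     longer suffix and keeps the key [3 * n]. *)
  have [->|/eqP Ni] := eqVneq i (n - m).+1.
    rewrite key_row; last by lia.
    rewrite /new_key eqxx /prev_row ifF; last by lia.
    have -> : (n - m).+1.-1 = (n - m.+1).+1 by lia.
    by rewrite key_row //; lia.
  have [|l HM] := mismatch_row (m := m) _ Hi Ni; first by lia.
  have [t [p Ep]] := rotation_rcons (n - m).+1.
  have [v [q Eq]] := rotation_rcons i.
  rewrite (tailS Hm Ep) (rotation_prev Hi Eq).
  have st := size_rotation (n - m).+1; have sv := size_rotation i.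
  move: HM; rewrite tail_rotation; last by lia.
  move: st sv; rewrite Ep Eq => st sv HM.
  by apply/esym/(new_key_step dollar st sv _ HM); lia.
by apply: perm_map; exact: perm_prev_row.
Qed.


(** The minimum has rank 0, so [alg_init] can start the text without knowing the alphabet. *)
Lemma code_dollar : code_s dollar = 0.
Proof.
have k0 : 0 < #|Ss| by apply/card_gt0P; exists dollar.
have := dollar_min (Order.enum_val (Ordinal k0)).
rewrite -(Order.le_enum_rank (@Order.le_total _ Ss)) Order.EnumVal.enum_valK.
by rewrite /code_s => H; have {}H : Order.enum_rank dollar <= 0 := H; lia.
Qed.

(** Every rotation but one starts with a symbol other than the end marker, so it is larger already
    at position 0. *)
Lemma keys1 : keys 1 = 3 * n :: nseq n.-1 (4 * n).
Proof.
have n0 := n_gt0; apply: (sorted_eq leq_trans anti_leq).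
- exact: sorted_keys.
- rewrite /=; have : 3 * n <= 4 * n by lia.
  by elim: n.-1 (3 * n) => //= k IH x Hx; rewrite Hx IH.
apply: perm_trans (perm_map _ perm_tau) _.
have -> : iota 1 n = iota 1 n.-1 ++ [:: n].
  by have := iotaD 1 n.-1 1; rewrite addn1 add1n prednK.
rewrite map_cat perm_catC /=.
have -> : key n (prev_enc (tail 1)) (row n) = 3 * n.
  by have := @key_row 1; rewrite subn1 prednK // => ->.
rewrite perm_cons.
set s := map _ _; suff /all_pred1P -> : all (pred1 (4 * n)) s.
  by rewrite size_map size_iota.
apply/allP => k /mapP[i]; rewrite mem_iota => Hi -> /=.
have Hs : 0 < size (row i) by rewrite size_prev_enc size_rotation.
rewrite tail1 /key (@key_from_hi _ _ _ 0 _ _ 0) ?subn0 //=.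
rewrite (nth_prev_enc x0) ?size_rotation // nth_rotation //; last by lia.
rewrite addn0 ifT; last by lia.
have : nth x0 T i.-1 <> inl dollar by move/nth_T; lia.
rewrite take0; case: (nth x0 T i.-1) => [a|p] //= Na.
rewrite Order.POrderTheory.lt_neqAle dollar_min andbT.
by apply/eqP => E; apply: Na; rewrite E.
Qed.

Definition rank_param p := index p (rev (params T)).

Definition text_code (x : Ss + Sp) : nat :=
  match x with inl a => code_s a | inr p => 2 * rank_param p + 1 end.

(** The reversed list of parameters of [T] begins with those of the known suffix and continues with
    [p], so the counter of the algorithm is the rank of [p]. *)
Lemma rank_param_new m p : m < n -> tail m.+1 = inr p :: tail m ->
  inr p \notin tail m -> rank_param p = size (params (tail m)).
Proof.
move=> Hm E Hp; rewrite /rank_param.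
have [s] := params_cat (take (n - m.+1) T) (tail m.+1).
rewrite cat_take_drop => ->; rewrite E params_param (negPf Hp) rev_cat rev_cons.
by rewrite cat_rcons index_cat mem_rev mem_params (negPf Hp) /= eqxx addn0 size_rev.
Qed.

Lemma zflags_cons_param p (w : seq (Ss + Sp)) :
  zflags (prev_enc (inr p :: w)) = true ::
    if inr p \in w then set_nth false (zflags (prev_enc w)) (index (inr p) w) false
    else zflags (prev_enc w).
Proof.
have sz := size_prev_enc w.
apply: (@eq_from_nth _ false).
  rewrite /= !size_map size_prev_from; case: ifP => Hp;
    rewrite ?size_set_nth ?size_map ?sz //.
  by congr _.+1; apply/esym/maxn_idPr; rewrite index_mem.
rewrite size_map size_prev_enc => -[|i] Hi //=;
  rewrite -[nth _ _ _]/(nth false (zflags (prev_enc (inr p :: w))) i.+1).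
rewrite nth_zflags ?size_prev_enc // nth_prev_cons //.
have [Hp|Hp] := boolP (inr p \in w); last first.
  rewrite ifF ?nth_zflags ?sz //; apply/negbTE/eqP => E; move: Hp.
  by rewrite -index_mem -E (Hi : i < size w).
by rewrite nth_set_nth /=; case: (i =P index _ w) => // _; rewrite nth_zflags ?sz.
Qed.

Lemma zflags_cons_static a (w : seq (Ss + Sp)) :
  zflags (prev_enc (inl a :: w)) = false :: zflags (prev_enc w).
Proof.
apply: (@eq_from_nth _ false); first by rewrite /= !size_map !size_prev_from.
rewrite size_map size_prev_enc => -[|i] Hi //=;
  rewrite -[nth _ _ _]/(nth false (zflags (prev_enc (inl a :: w))) i.+1).
by rewrite !nth_zflags ?size_prev_enc // nth_prev_cons.
Qed.

(** The loop invariant of the algorithm in closed form: each state is a function of the text and [m]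
    alone. *)
Lemma alg_atE m : 0 < m <= n -> alg_at n L m =
  Alg (map text_code (tail m)) (zflags (prev_enc (tail m))) (keys m)
      (size (params (tail m))).
Proof.
case: m => // m; elim: m => [|m IH] Hm.
  by rewrite /alg_at /= /alg_init keys1 tail1 /= code_dollar.
rewrite alg_atS // {}IH; last by lia.
have Hm1 : 0 < m.+1 < n by lia.
have Hm2 : 0 < m.+1 <= n by lia.
have [t [x Ex]] := rotation_rcons (n - m.+1).+1.
have ES := tailS Hm1 Ex.
rewrite /alg_next new_keys_keys // next_code_keys // Ex.
have sm := size_tail (ltnW Hm).
have stp : size (rcons t x) = n by rewrite -Ex size_rotation.
case: x Ex ES stp => [a|p] Ex ES stp.
  by rewrite pBWT_symbol_static code_L_static ES zflags_cons_static.
rewrite pBWT_symbol_param (code_L_param Ss _).1 eqxx.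
have Eu : tail m.+1 = take m.+1 (rcons t (inr p)) by rewrite -Ex tail_rotation
  //; lia.
have -> : first_occ n (zflags (prev_enc (tail m.+1)))
    (code_L (inr (param_rank (rcons t (inr p)) p) : Ss + nat)) =
    if inr p \in tail m.+1 then index (inr p) (tail m.+1) else n.
  rewrite {1}Eu first_occ_param ?mem_rcons ?mem_head //; last by lia.
  by rewrite -Eu -[X in _ < X]sm index_mem.
rewrite ES zflags_cons_param params_param.
have [Hp|Hp] := boolP (inr p \in tail m.+1); last first.
  by rewrite ltnn /= (rank_param_new _ ES Hp) ?addn1 //; lia.
have Hi : index (inr p) (tail m.+1) < m.+1 by rewrite -[X in _ < X]sm index_mem.
have -> : index (inr p) (tail m.+1) < n by apply: leq_trans Hi _; lia.
by rewrite (nth_map x0) ?index_mem // nth_index.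
Qed.

Lemma alg_at_good m : 0 < m <= n ->
  [/\ size (aY (alg_at n L m)) = m, size (aF (alg_at n L m)) = m,
      aN (alg_at n L m) <= m & valid_keys n m (aK (alg_at n L m))].
Proof.
move=> Hm; have sm : size (tail m) = m by apply: size_tail; lia.
rewrite alg_atE //= !size_map size_prev_enc sm; split=> //.
  by have := size_params (tail m); rewrite sm.
exact: valid_keys_keys.
Qed.

Lemma size_L : size L = n.
Proof. by rewrite L_map size_map size_tau. Qed.

Lemma code_s_lt (a : Ss) : code_s a < 2 * #|Ss|.
Proof. by rewrite /code_s -muln2 mulnC ltn_mul2l; exact: ltn_ord. Qed.

Lemma L_bound x : x \in L -> x != 1 /\ x < 2 * (n + #|Ss|) + 2.
Proof.
rewrite L_map => /mapP[i _ ->]; have [t [[a|p] E]] := rotation_rcons i; rewrite E.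
  rewrite pBWT_symbol_static /=; have H := code_s_lt a.
  split; first by rewrite /code_s; lia.
  apply: leq_trans H _; rewrite mulnDr -addnA.
  exact: leq_trans (leq_addr 2 _) (leq_addl _ _).
rewrite pBWT_symbol_param /= /param_rank -E.
set k := nzeros _ _; suff Hk : k < n by split; lia.
apply: leq_ltn_trans (nzeros_le _ _) _; rewrite -(size_rotation i) index_mem E.
by rewrite mem_rcons mem_head.
Qed.

Lemma ram_pbwt_inverse w : 1000 * (n + #|Ss|) <= 2 ^ w ->
  ram_computes w (1000 * n) (1000 * n ^ 2) pbwt_inverse L (map text_code T).
Proof.
move=> Hw; have n0 := n_gt0.
have H : ram_computes w (1000 * n) (main_time n) pbwt_inverse L (aY (alg_at n L n)).
  apply: pbwt_inverse_correct => //; [lia | lia | exact: size_L | | | ].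
  - by apply/negP => /L_bound[].
  - exact: alg_at_good.
  - by apply/allP => x /L_bound[_ Hx]; lia.
move: H; rewrite alg_atE ?n0 ?leqnn // tail_full [aY _]/=.
case=> s1 s2 [k [s [Hk Hs Hh Ho]]]; split=> //; exists k, s; split=> //.
exact: leq_trans Hk (main_time_le n0).
Qed.

End Inversion.

(** Completing [s] to an enumeration of [Sp] and matching it with the ordered one gives the
    permutation. It turns discovery numbers into ranks, as the output format requires. *)
Lemma perm_of_uniq (dp : Order.disp_t) (Sp : finOrderType dp) (s : seq Sp) :
  uniq s -> exists g : {perm Sp},
    forall p, p \in s -> Order.enum_rank (g p) = index p s :> nat.
Proof.
move=> Us; pose s' := s ++ [seq p <- enum Sp | p \notin s].
have Hs' p : p \in s' by rewrite mem_cat mem_filter mem_enum andbT orbN.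
have Us' : uniq s'.
  rewrite cat_uniq Us filter_uniq ?enum_uniq // andbT.
  by apply/hasPn => p; rewrite mem_filter => /andP[].
have Ps' : perm_eq s' (enum Sp).
  by apply: uniq_perm; rewrite ?enum_uniq // => p; rewrite Hs' mem_enum.
have Hi p : index p s' < #|Sp| by rewrite cardE -(perm_size Ps') index_mem.
pose f p := Order.enum_val (Ordinal (Hi p)).
have f_inj : injective f.
  move=> p q /Order.EnumVal.enum_val_inj [] /(congr1 (nth p s')).
  by rewrite !nth_index.
exists (perm f_inj) => p Hp; rewrite permE Order.EnumVal.enum_valK /=.
by rewrite index_cat Hp.
Qed.

(* A single program and a single constant serve all alphabets, all texts, and
   all word sizes w in Omega (log (n + |Ss| + |Sp|)). *)
Theorem theorem3 :
  exists (P : program) (c : nat),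
    forall (ds dp : Order.disp_t)
           (Ss : finOrderType ds) (Sp : finOrderType dp)
           (dollar : Ss) (n : nat) (T : seq (Ss + Sp)) (w : nat),
      (forall a : Ss, (dollar <= a)%O) ->
      size T = n ->
      terminated dollar T ->
      c * (n + #|Ss| + #|Sp|) <= 2 ^ w ->
      exists Y : seq (Ss + Sp),
        p_match Y T /\
        ram_computes w (c * n) (c * n ^ 2) P
          (map (@code_L _ Ss) (pBWT dollar T))
          (map (@code_p _ _ Ss Sp) Y).
Proof.
exists pbwt_inverse, 1000 => ds dp Ss Sp dollar n T w dollar_min <- [T' ET HT'] Hw.
have [|g Hg] := @perm_of_uniq _ Sp (rev (params T));
  first by rewrite rev_uniq undup_uniq.
(* The output is the text with its p-symbols renamed by order of discovery from the right; the
   inverse of [g] leads back to [T]. *)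
exists (map (subst_param g) T); split.
  exists g^-1%g; rewrite -map_comp -[LHS]map_id; apply: eq_map => -[a|p] //=.
  by rewrite permK.
have -> : map (@code_p _ _ Ss Sp) (map (subst_param g) T) = map (text_code
  dollar T') T.
  rewrite -map_comp; apply/eq_in_map => -[a|p] //= Hp.
  rewrite Hg ?mem_rev ?mem_params // /rank_param -ET; lia.
rewrite ET; apply: ram_pbwt_inverse => //; rewrite -ET; apply: leq_trans Hw.
by rewrite leq_mul2l leq_addr orbT.
Qed.
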